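(* Let $T$ be a closed densely defined operator in a complex Hilbert space $\mathcal H$ and let $n$ be an integer greater than $1$. Suppose that $T$ is subnormal and $T^n$ is quasinormal. Then $T$ is quasinormal.
   Context: Operators are linear, possibly unbounded; $T^n$ has its natural domain $\mathcal D(T^n)=\{h: h\in\mathcal D(T),\,Th\in\mathcal D(T^{n-1})\}$. A closed densely defined operator $T$ in $\mathcal H$ is quasinormal if $T(T^*T)=(T^*T)T$ (equality of operators including domains); equivalently, $E(\Delta)T\subseteq TE(\Delta)$ for every Borel set $\Delta\subseteq[0,\infty)$, where $E$ is the spectral measure of $|T|=(T^*T)^{1/2}$. A densely defined operator $T$ in $\mathcal H$ is subnormal if there exist a complex Hilbert space $\mathcal K\supseteq\mathcal H$ (isometric embedding) and a normal operator $N$ in $\mathcal K$ with $\mathcal D(T)\subseteq\mathcal D(N)$ and $Th=Nh$ for all $h\in\mathcal D(T)$. *)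

(* Defs.v *)
From HB Require Import structures.
From mathcomp Require Import all_boot all_order all_algebra.
From mathcomp Require Import reals.
From mathcomp Require Import complex.
From Stdlib Require Import ClassicalEpsilon.
Set Implicit Arguments. Unset Strict Implicit. Unset Printing Implicit Defensive.
Import Order.TTheory GRing.Theory Num.Theory.
Local Open Scope ring_scope.
Local Open Scope complex_scope.

Section Defs.
Variable R : realType.
Local Notation C := (R[i]).

Section InnerProduct.
Variables (V : lmodType C) (ip : V -> V -> C).

Definition sqnorm (x : V) : C := ip x x.

Definition seq_converges (u : nat -> V) (l : V) : Prop :=
  forall eps : C, 0 < eps -> exists N : nat, forall m, (N <= m)%N ->
    sqnorm (u m - l) < eps.

Definition seq_cauchy (u : nat -> V) : Prop :=
  forall eps : C, 0 < eps -> exists N : nat, forall m k, (N <= m)%N -> (N <= k)%N ->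
    sqnorm (u m - u k) < eps.
End InnerProduct.

Record hilbertSpace := HilbertSpace {
  hcar :> lmodType C;
  hip : hcar -> hcar -> C;
  hip_linl : forall (a : C) (x y z : hcar), hip (a *: x + y) z = a * hip x z + hip y z;
  hip_sym : forall x y : hcar, hip y x = (hip x y)^*;
  hip_ge0 : forall x : hcar, 0 <= hip x x;
  hip_def : forall x : hcar, hip x x = 0 -> x = 0;
  hcomplete : forall u : nat -> hcar, seq_cauchy hip u -> exists l, seq_converges hip u l
}.

Section Operators.
Variable H : hilbertSpace.

(* an operator in H: a domain together with an action (relevant on the domain) *)
Record op := Op { dom : H -> Prop; app : H -> H }.

Definition is_subspace (D : H -> Prop) : Prop :=
  D 0 /\ forall (a : C) (x y : H), D x -> D y -> D (a *: x + y).

Definition linear_op (T : op) : Prop :=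
  is_subspace (dom T) /\
  forall (a : C) (x y : H), dom T x -> dom T y ->
    app T (a *: x + y) = a *: app T x + app T y.

Definition op_eq (S T : op) : Prop :=
  (forall x, dom S x <-> dom T x) /\ (forall x, dom S x -> app S x = app T x).

Definition densely_defined (T : op) : Prop :=
  forall (x : H) (eps : C), 0 < eps -> exists y, dom T y /\ sqnorm (@hip H) (x - y) < eps.

Definition closed_op (T : op) : Prop :=
  forall (u : nat -> H) (x y : H), (forall m, dom T (u m)) ->
    seq_converges (@hip H) u x -> seq_converges (@hip H) (fun m => app T (u m)) y ->
    dom T x /\ app T x = y.

Definition op_comp (S T : op) : op :=
  Op (fun x => dom T x /\ dom S (app T x)) (fun x => app S (app T x)).

Definition op_id : op := Op (fun _ => True) id.

Fixpoint op_pow (T : op) (n : nat) : op :=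
  match n with 0 => op_id | n'.+1 => op_comp (op_pow T n') T end.

(* adjoint: y in D(T* ) iff exists z with <Tx,y> = <x,z> for all x in D(T);
   T* y is such a z (unique when T is densely defined). *)
Definition adj_rel (T : op) (y z : H) : Prop :=
  forall x, dom T x -> hip (app T x) y = hip x z.

Definition op_adj (T : op) : op :=
  Op (fun y => exists z, adj_rel T y z)
     (fun y => epsilon (inhabits (0 : H)) (adj_rel T y)).

Definition closed_densely_defined (T : op) : Prop :=
  linear_op T /\ densely_defined T /\ closed_op T.

Definition quasinormal (T : op) : Prop :=
  closed_densely_defined T /\
  op_eq (op_comp T (op_comp (op_adj T) T)) (op_comp (op_comp (op_adj T) T) T).

Definition normal (N : op) : Prop :=
  closed_densely_defined N /\
  op_eq (op_comp (op_adj N) N) (op_comp N (op_adj N)).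
End Operators.

Definition isometric_embedding (H K : hilbertSpace) (J : H -> K) : Prop :=
  (forall (a : C) (x y : H), J (a *: x + y) = a *: J x + J y) /\
  (forall x y : H, hip (J x) (J y) = hip x y).

Definition subnormal (H : hilbertSpace) (T : op H) : Prop :=
  linear_op T /\ densely_defined T /\
  exists (K : hilbertSpace) (J : H -> K) (N : op K),
    isometric_embedding J /\ normal N /\
    forall h, dom T h -> dom N (J h) /\ app N (J h) = J (app T h).
End Defs.

(* Main.v *)
From Stdlib Require ClassicalEpsilon.
From HB Require Import structures.
Require Import Defs.
From mathcomp Require Import all_boot all_order all_algebra.
From mathcomp Require Import boolp classical_sets reals complex ring lra.

(* Let N be a normal extension of T acting in K, let J embed H in K, and put C = (1 + N^*N)^-1,
   S = T^n, r = (1 + S^*S)^-1.  Quasinormality of S gives |S^2 h| = |S^*S h| on the range of r^2,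
   while S^*S h is the compression to H of (N^*N)^n h, whose norm is at most |N^(2n) h| = |S^2 h|.
   The compression therefore preserves the norm, so (N^*N)^n h = S^*S h, and by density
   (C^n + (1 - C)^n) J r = C^n J.  Hence J H is stable under Y = (1 + (N^*N)^n)^-1 and under
   the n-th power (1 - Y) Y^(n-1) of the bounded positive operator N^*N Y, thus under N^*N Y itself,
   because a positive n-th root is a strong limit of polynomials.  It follows that J H reduces C,
   that T is the part of N in J H, and that (1 + T^*T)^-1 is the restriction of C, so that the
   commutation of N with N^*N passes to T.

   Only the real structure matters: complex spaces are replaced by their underlying real Hilbert
   spaces, and unbounded operators by their graphs. *)

Set Implicit Arguments. Unset Strict Implicit. Unset Printing Implicit Defensive.
Import Order.TTheory GRing.Theory Num.Theory.
Local Open Scope ring_scope.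

(** * Real Hilbert spaces and orthogonal projection *)

Record rhilb (R : realType) := RHilb {
  rcar :> lmodType R;
  rip : rcar -> rcar -> R;
  rip_linl : forall a x y z, rip (a *: x + y) z = a * rip x z + rip y z;
  rip_sym : forall x y, rip y x = rip x y;
  rip_ge0 : forall x, 0 <= rip x x;
  rip_def : forall x, rip x x = 0 -> x = 0;
  rip_complete : forall u : nat -> rcar,
    (forall e : R, 0 < e -> exists N, forall m k, (N <= m)%N -> (N <= k)%N ->
       rip (u m - u k) (u m - u k) < e) ->
    exists l, forall e : R, 0 < e -> exists N, forall m, (N <= m)%N ->
       rip (u m - l) (u m - l) < e
}.

Arguments rip : simpl never.

Section Norm.
Variables (R : realType) (H : rhilb R).
Implicit Types (x y z l : H) (a e : R) (V : H -> Prop).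

Definition nm x : R := Num.sqrt (rip x x).

Lemma ripDl x y z : rip (x + y) z = rip x z + rip y z.
Proof. by rewrite -[x]scale1r rip_linl mul1r scale1r. Qed.
Lemma rip0l z : rip 0 z = 0.
Proof. by have := ripDl 0 0 z; rewrite addr0; lra. Qed.
Lemma ripZl a x z : rip (a *: x) z = a * rip x z.
Proof. by rewrite -[a *: x]addr0 rip_linl rip0l addr0. Qed.
Lemma ripNl x z : rip (- x) z = - rip x z.
Proof. by rewrite -scaleN1r ripZl mulN1r. Qed.
Lemma ripBl x y z : rip (x - y) z = rip x z - rip y z.
Proof. by rewrite ripDl ripNl. Qed.
Lemma ripDr x y z : rip z (x + y) = rip z x + rip z y.
Proof. by rewrite ![rip z _]rip_sym ripDl. Qed.
Lemma rip0r z : rip z 0 = 0.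
Proof. by rewrite rip_sym rip0l. Qed.
Lemma ripZr a x z : rip z (a *: x) = a * rip z x.
Proof. by rewrite ![rip z _]rip_sym ripZl. Qed.
Lemma ripNr x z : rip z (- x) = - rip z x.
Proof. by rewrite ![rip z _]rip_sym ripNl. Qed.
Lemma ripBr x y z : rip z (x - y) = rip z x - rip z y.
Proof. by rewrite ripDr ripNr. Qed.
Definition ripE := (ripDl, ripDr, ripNl, ripNr, ripZl, ripZr, rip0l, rip0r).

Lemma nm_ge0 x : 0 <= nm x. Proof. exact: sqrtr_ge0. Qed.
Lemma nm_sq x : nm x ^+ 2 = rip x x. Proof. by rewrite sqr_sqrtr // rip_ge0. Qed.
Lemma nm_eq0 x : nm x = 0 -> x = 0.
Proof. by move=> h; apply: rip_def; rewrite -nm_sq h expr0n. Qed.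
Lemma nm0 : nm 0 = 0. Proof. by rewrite /nm rip0l sqrtr0. Qed.
Lemma nmN x : nm (- x) = nm x.
Proof. by rewrite /nm !ripE opprK. Qed.
Lemma nmB x y : nm (x - y) = nm (y - x).
Proof. by rewrite -nmN opprB. Qed.
Lemma nmZ a x : nm (a *: x) = `|a| * nm x.
Proof.
by rewrite /nm !ripE mulrA -expr2 sqrtrM ?sqr_ge0 // sqrtr_sqr.
Qed.

(** The squared norm of [rip y y *: x - rip x y *: y] factors as |y|^2 (|x|^2 |y|^2 - <x, y>^2), so
    the second factor is nonnegative once y is nonzero. *)
Lemma cauchy_schwarz x y : rip x y <= nm x * nm y.
Proof.
have [y0|y0] := eqVneq y 0; first by rewrite y0 rip0r mulr_ge0 ?nm_ge0.
have yp : 0 < rip y y.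
  by rewrite lt_def rip_ge0 andbT; apply: contra_neq y0; exact: rip_def.
apply: le_trans (ler_norm _) _.
rewrite -(@ler_pXn2r _ 2) ?nnegrE ?mulr_ge0 ?nm_ge0 // exprMn !nm_sq real_normK ?num_real //.
have := rip_ge0 (rip y y *: x - rip x y *: y).
rewrite !ripE (rip_sym x y); set s := rip y y in yp *; set t := rip x y.
set q := rip x x => h.
have : 0 <= s * (q * s - t ^+ 2) by move: h; rewrite expr2; lra.
by rewrite pmulr_rge0 // subr_ge0.
Qed.

Lemma nmD x y : nm (x + y) <= nm x + nm y.
Proof.
rewrite -(@ler_pXn2r _ 2) ?nnegrE ?addr_ge0 ?nm_ge0 // nm_sq sqrrD !nm_sq !ripE.
rewrite (rip_sym x y); have := cauchy_schwarz x y; lra.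
Qed.
Lemma nm_le x y : rip x x <= rip y y -> nm x <= nm y.
Proof. by move=> h; rewrite ler_sqrt ?rip_ge0. Qed.

Definition subsp V := V 0 /\ forall a x y, V x -> V y -> V (a *: x + y).
Definition adh V l := forall e, 0 < e -> exists v, V v /\ nm (l - v) < e.
Definition closedS V := forall l, adh V l -> V l.

Lemma subspD V x y : subsp V -> V x -> V y -> V (x + y).
Proof. by move=> [_ h] vx vy; rewrite -[x]scale1r; exact: h. Qed.
Lemma subspZ V a x : subsp V -> V x -> V (a *: x).
Proof. by move=> [v0 h] vx; rewrite -[a *: x]addr0; exact: h. Qed.
Lemma subspB V x y : subsp V -> V x -> V y -> V (x - y).
Proof. by move=> hV vx vy; apply: subspD => //; rewrite -scaleN1r; exact: subspZ. Qed.

Lemma nm_small x : (forall e, 0 < e -> nm x <= e) -> x = 0.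
Proof.
move=> h; apply: nm_eq0; apply/eqP; rewrite eq_le nm_ge0 andbT.
by apply/ler_addgt0Pl => e e0; rewrite addr0 h.
Qed.
Lemma adh_orth V l y : adh V l -> (forall v, V v -> rip v y = 0) -> rip l y = 0.
Proof.
move=> al h.
have key e : 0 < e -> `|rip l y| <= e * nm y.
  move=> /al[v [vv lv]]; have -> : rip l y = rip (l - v) y by rewrite ripBl (h _ vv) subr0.
  have nle : nm (l - v) * nm y <= e * nm y by apply: ler_wpM2r; [exact: nm_ge0|exact: ltW].
  rewrite ler_norml; have := cauchy_schwarz (l - v) y.
  have := cauchy_schwarz (- (l - v)) y; rewrite nmN ripNl.
  by move=> h1 h2; apply/andP; split; lra.
apply/eqP; rewrite -normr_le0; apply/ler_addgt0Pl => e e0; rewrite addr0.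
have ny := nm_ge0 y; have p : 0 < nm y + 1 by lra.
apply: le_trans (key (e / (nm y + 1)) (divr_gt0 e0 p)) _.
have le1 : (nm y + 1)^-1 * nm y <= 1 by rewrite mulrC ler_pdivrMr //; lra.
by rewrite -mulrA ler_piMr // ltW.
Qed.

Lemma small_inv e : 0 < e -> exists N : nat, forall m, (N <= m)%N -> m.+1%:R^-1 < e.
Proof.
move=> e0; exists (Num.bound e^-1) => m hm.
rewrite -[e]invrK ltf_pV2 ?posrE ?invr_gt0 ?ltr0n //.
apply: lt_le_trans (archi_boundP _) _; first by rewrite invr_ge0 ltW.
by rewrite ler_nat (leq_trans hm).
Qed.

Lemma cauchy_lim (u : nat -> H) :
  (forall m k, rip (u m - u k) (u m - u k) <= m.+1%:R^-1 + k.+1%:R^-1) ->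
  exists l, forall e, 0 < e -> exists N, forall m, (N <= m)%N -> nm (l - u m) < e.
Proof.
move=> hu; have [l hl] : exists l, forall e : R, 0 < e -> exists N, forall m, (N <= m)%N ->
       rip (u m - l) (u m - l) < e.
  apply: rip_complete => e e0; have [|N hN] := @small_inv (e / 2); first by rewrite divr_gt0.
  exists N => m k hm hk; apply: le_lt_trans (hu m k) _.
  by rewrite [e]splitr ltrD ?hN.
exists l => e e0; have [|N hN] := hl (e ^+ 2); first by rewrite exprn_gt0.
exists N => m /hN; rewrite -nm_sq nmB ltr_pXn2r // ?nnegrE ?nm_ge0 //; exact: ltW.
Qed.

(** A minimising sequence for the distance from [x] is Cauchy. [V] is only a linear subspace, hence
    [p] is placed in its closure. *)
Lemma projection V x : subsp V ->
  exists p, adh V p /\ forall v, V v -> rip (x - p) v = 0.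
Proof.
move=> hV; pose E : set R := [set s | exists2 v, V v & s = rip (x - v) (x - v)]%classic.
have hE : has_inf E.
  split; first by exists (rip (x - 0) (x - 0)), 0 => //; case: hV.
  by exists 0 => _ [v _ ->]; exact: rip_ge0.
pose d := inf E.
have dle v : V v -> d <= rip (x - v) (x - v).
  by move=> vv; apply: ge_inf; [case: hE | exists v].
have /choice[u hu] (m : nat) : exists v, V v /\ rip (x - v) (x - v) < d + (4 * m.+1%:R)^-1.
  have [|_ [v vv ->] lt] := @inf_adherent _ E (4 * m.+1%:R)^-1 _ hE.
    by rewrite invr_gt0 mulr_gt0.
  by exists v.
have [|p hp] := cauchy_lim (u := u).
  move=> m k; have [um lm] := hu m; have [uk lk] := hu k.
  (* Parallelogram law: the midpoint is at squared distance at least d from x, so |u m - u k|^2 is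
     at most twice the sum of the two excesses over d. *)
  have := dle (2^-1 *: (u m + u k)) (subspZ _ hV (subspD hV um uk)).
  have h4 (j : nat) : j.+1%:R^-1 = 4 * (4 * j.+1%:R)^-1 :> R by rewrite invfM mulrA divff ?mul1r // pnatr_eq0.
  have p4 (j : nat) : 0 < (4 * j.+1%:R)^-1 :> R by rewrite invr_gt0 mulr_gt0.
  rewrite (h4 m) (h4 k); move: lm lk (p4 m) (p4 k); set sm := (4 * m.+1%:R)^-1.
  set sk := (4 * k.+1%:R)^-1; rewrite !ripE (rip_sym x (u m)) (rip_sym x (u k)).
  by rewrite (rip_sym (u m) (u k)) => *; apply/ltW; lra.
have ap : adh V p by move=> e /hp[N hN]; exists (u N); split; [case: (hu N)|exact: hN].
have d0 : 0 <= d by apply: lb_le_inf; [case: hE|move=> _ [v _ ->]; exact: rip_ge0].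
have lo v : V v -> Num.sqrt d <= nm (x - p - v).
  move=> vv; apply/ler_addgt0Pl => e /hp[N hN]; have [uN _] := hu N.
  have : Num.sqrt d <= nm (x - (u N + v)) by rewrite ler_sqrt ?rip_ge0 //; apply: dle; exact: subspD.
  move=> h1; apply: le_trans h1 _.
  have -> : x - (u N + v) = (p - u N) + (x - p - v).
    by rewrite [x - p - v]addrAC [RHS]addrC subrKA addrAC -addrA -opprD.
  by apply: le_trans (nmD _ _) _; rewrite lerD2r; exact/ltW/hN.
have hi : rip (x - p) (x - p) <= d.
  rewrite -nm_sq -[leRHS]sqr_sqrtr // ler_pXn2r ?nnegrE ?nm_ge0 ?sqrtr_ge0 //.
  apply/ler_addgt0Pl => e e0; have e2 : 0 < e / 2 by lra.
  have [N1 h1] := hp _ e2; have [|N2 h2] := @small_inv ((e / 2) ^+ 2); first by rewrite exprn_gt0.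
  pose m := maxn N1 N2; have [um lm] := hu m.
  have : nm (x - u m) <= Num.sqrt d + e / 2.
    rewrite -(@ler_pXn2r _ 2) ?nnegrE ?nm_ge0 ?addr_ge0 ?sqrtr_ge0 ?(ltW e2) // nm_sq sqrrD sqr_sqrtr //.
    have := h2 m (leq_maxr _ _); have sd := mulr_ge0 (sqrtr_ge0 d) (ltW e2).
    have : (4 * m.+1%:R)^-1 <= m.+1%:R^-1 :> R by rewrite invfM ler_piMl ?invr_ge0 ?ler0n //; lra.
    by set s := (4 * _)^-1 in lm *; set s' := m.+1%:R^-1; lra.
  have := h1 m (leq_maxl _ _); have := nmD (x - u m) (u m - p).
  by rewrite subrKA [nm (u m - p)]nmB; lra.
exists p; split=> // v vv; set q := x - p in lo hi *; clearbody q.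
(* First-order condition: moving p by t v cannot decrease the distance. The choice t = <q, v> / <v,
   v> below then forces <q, v> = 0. *)
have key t : 0 <= t ^+ 2 * rip v v - 2 * t * rip q v.
  have := lo _ (subspZ t hV vv).
  rewrite -(@ler_pXn2r _ 2) ?nnegrE ?nm_ge0 ?sqrtr_ge0 // sqr_sqrtr // nm_sq !ripE (rip_sym q v).
  by move: hi; rewrite expr2; lra.
have [v0|v0] := eqVneq (rip v v) 0; first by rewrite (rip_def v0) rip0r.
have := key (rip q v / rip v v); rewrite expr2.
have -> : rip q v / rip v v * (rip q v / rip v v) * rip v v - 2 * (rip q v / rip v v) * rip q v
  = - (rip q v ^+ 2 / rip v v) by field.
have vp : 0 < rip v v by rewrite lt_def v0 rip_ge0.
rewrite oppr_ge0 pmulr_lle0 ?invr_gt0 // => h; apply/eqP; rewrite -sqrf_eq0; apply/eqP/le_anti.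
by rewrite h sqr_ge0.
Qed.
End Norm.

(** * Products, adherence and closed graphs *)

Section Product.
Variables (R : realType) (H1 H2 : rhilb R).
Local Notation P := (H1 * H2)%type.

Definition prip (p q : P) : R := rip p.1 q.1 + rip p.2 q.2.

Lemma prip_linl a (x y z : P) : prip (a *: x + y) z = a * prip x z + prip y z.
Proof. by rewrite /prip /= !ripE; ring. Qed.
Lemma prip_sym (x y : P) : prip y x = prip x y.
Proof. by rewrite /prip [rip y.1 _]rip_sym [rip y.2 _]rip_sym. Qed.
Lemma prip_ge0 (x : P) : 0 <= prip x x.
Proof. by rewrite addr_ge0 ?rip_ge0. Qed.
Lemma prip_def (x : P) : prip x x = 0 -> x = 0.
Proof.
case: x => x y /eqP; rewrite paddr_eq0 ?rip_ge0 // => /andP[/eqP hx /eqP hy].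
by congr (_, _); exact: rip_def.
Qed.
Lemma prip_complete (u : nat -> P) :
  (forall e : R, 0 < e -> exists N, forall m k, (N <= m)%N -> (N <= k)%N ->
     prip (u m - u k) (u m - u k) < e) ->
  exists l, forall e : R, 0 < e -> exists N, forall m, (N <= m)%N ->
     prip (u m - l) (u m - l) < e.
Proof.
move=> hu.
have [|l1 h1] := @rip_complete R H1 (fun m => (u m).1).
  move=> e /hu[N hN]; exists N => m k hm hk; apply: le_lt_trans (hN m k hm hk).
  by rewrite lerDl rip_ge0.
have [|l2 h2] := @rip_complete R H2 (fun m => (u m).2).
  move=> e /hu[N hN]; exists N => m k hm hk; apply: le_lt_trans (hN m k hm hk).
  by rewrite lerDr rip_ge0.
exists (l1, l2) => e e0; have e2 : 0 < e / 2 by rewrite divr_gt0.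
have [N1 k1] := h1 _ e2; have [N2 k2] := h2 _ e2; exists (maxn N1 N2) => m hm.
rewrite [e]splitr ltrD ?k1 ?k2 //; apply: leq_trans hm; [exact: leq_maxl|exact: leq_maxr].
Qed.

(** The orthogonal sum: graphs of operators are subspaces of it, so closures and projections apply
    to them. *)
Definition prodh : rhilb R :=
  RHilb prip_linl prip_sym prip_ge0 prip_def prip_complete.

Lemma rip_pair (p q : prodh) : rip p q = rip p.1 q.1 + rip p.2 q.2.
Proof. by []. Qed.
Lemma nm_fst (p : prodh) : nm p.1 <= nm p.
Proof. by rewrite ler_sqrt ?prip_ge0 // lerDl rip_ge0. Qed.
Lemma nm_snd (p : prodh) : nm p.2 <= nm p.
Proof. by rewrite ler_sqrt ?prip_ge0 // lerDr rip_ge0. Qed.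
Lemma nm_pair (p : prodh) : nm p <= nm p.1 + nm p.2.
Proof.
rewrite -(@ler_pXn2r _ 2) ?nnegrE ?addr_ge0 ?nm_ge0 // nm_sq sqrrD !nm_sq.
by rewrite addrAC lerDl mulrn_wge0 // mulr_ge0 ?nm_ge0.
Qed.
End Product.

(** * Closures, extension by continuity and dense ranges *)

Section Adherence.
Variable R : realType.

Definition contraction (H1 H2 : rhilb R) (f : H1 -> H2) := forall x, nm (f x) <= nm x.

Lemma adh_map (H1 H2 : rhilb R) (f : {linear H1 -> H2}) (V : H1 -> Prop) (W : H2 -> Prop) l :
  contraction f -> (forall v, V v -> W (f v)) -> adh V l -> adh W (f l).
Proof.
move=> cf h al e /al[v [vv lv]]; exists (f v); split; first exact: h.
by rewrite -linearB; apply: le_lt_trans lv.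
Qed.

Lemma adh_closed (H1 H2 : rhilb R) (f : {linear H1 -> H2}) (V : H1 -> Prop) (W : H2 -> Prop) l :
  contraction f -> closedS W -> (forall v, V v -> W (f v)) -> adh V l -> W (f l).
Proof. by move=> cf cW h al; apply: cW; exact: adh_map al. Qed.

Definition gsub (H1 H2 : rhilb R) (T : H1 -> H2 -> Prop) :=
  subsp (fun p : prodh H1 H2 => T p.1 p.2).
Definition gclosed (H1 H2 : rhilb R) (T : H1 -> H2 -> Prop) :=
  closedS (fun p : prodh H1 H2 => T p.1 p.2).
Definition functional (H1 H2 : rhilb R) (T : H1 -> H2 -> Prop) :=
  forall x y y', T x y -> T x y' -> y = y'.

Lemma gsubD (H1 H2 : rhilb R) (T : H1 -> H2 -> Prop) x y x' y' :
  gsub T -> T x y -> T x' y' -> T (x + x') (y + y').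
Proof. by move=> hT h h'; have := @subspD R (prodh H1 H2) _ (x, y) (x', y') hT h h'. Qed.
Lemma gsubB (H1 H2 : rhilb R) (T : H1 -> H2 -> Prop) x y x' y' :
  gsub T -> T x y -> T x' y' -> T (x - x') (y - y').
Proof. by move=> hT h h'; have := @subspB R (prodh H1 H2) _ (x, y) (x', y') hT h h'. Qed.
Lemma gsubP (H1 H2 : rhilb R) (T : H1 -> H2 -> Prop) a x y x' y' :
  gsub T -> T x y -> T x' y' -> T (a *: x + x') (a *: y + y').
Proof. by move=> [_ hT] h h'; have := hT a (x, y) (x', y') h h'. Qed.

(** Extension by continuity for a linear relation [F] dominated by a contraction [f]: approximants
    of [l] in the domain have Cauchy images. It replaces bounded inverses and continuous extensions
    throughout. *)
Lemma contractive_extension (H1 H2 H3 : rhilb R) (F : H1 -> H2 -> Prop)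
    (f : {linear H1 -> H3}) l :
  contraction f -> gsub F -> (forall x y, F x y -> nm y <= nm (f x)) -> adh (fun x => exists y, F x y) l ->
  exists m, adh (fun p : prodh H1 H2 => F p.1 p.2) (l, m) /\ nm m <= nm (f l).
Proof.
(* With a_m^2 = 1/(2(m+1)), the bound (a_m + a_k)^2 <= 2 a_m^2 + 2 a_k^2 is exactly the rate
   required by [cauchy_lim]. *)
move=> ctr gF cF al; pose a (m : nat) : R := Num.sqrt (m.+1%:R^-1 / 2).
have a2 m : a m ^+ 2 = m.+1%:R^-1 / 2 by rewrite sqr_sqrtr // divr_ge0 ?invr_ge0 ?ler0n.
have a0 m : 0 < a m by rewrite sqrtr_gt0 divr_gt0 ?invr_gt0 ?ltr0n.
have /choice[v hv] (m : nat) : exists p : H1 * H2, F p.1 p.2 /\ nm (l - p.1) < a m.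
  by have [x [[y Fxy] lx]] := al _ (a0 m); exists (x, y).
have [|y hy] := cauchy_lim (u := fun m => (v m).2).
  move=> m k; have [Fm lm] := hv m; have [Fk lk] := hv k.
  rewrite -nm_sq; have h1 := le_trans (cF _ _ (gsubB gF Fm Fk)) (ctr _).
  have h2 : nm ((v m).1 - (v k).1) <= a m + a k.
    have -> : (v m).1 - (v k).1 = (l - (v k).1) - (l - (v m).1) by rewrite opprB [RHS]addrC subrKA.
    by apply: le_trans (nmD _ _) _; rewrite nmN addrC lerD // ltW.
  have h3 := le_trans h1 h2; apply: (@le_trans _ _ ((a m + a k) ^+ 2)).
    by rewrite ler_pXn2r ?nnegrE ?nm_ge0 // addr_ge0 // ltW.
  have := sqr_ge0 (a m - a k); rewrite sqrrB sqrrD !a2.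
  by set s := m.+1%:R^-1; set t := k.+1%:R^-1; lra.
have sm e : 0 < e -> exists m, nm (l - (v m).1) < e /\ nm (y - (v m).2) < e.
  move=> e0; have [N hN] := hy _ e0; have [|N' hN'] := @small_inv R (e ^+ 2); first by rewrite exprn_gt0.
  exists (maxn N N'); split; last by apply: hN; exact: leq_maxl.
  apply: lt_trans (proj2 (hv _)) _; rewrite -(@ltr_pXn2r _ 2) ?nnegrE ?(ltW e0) ?(ltW (a0 _)) // a2.
  apply: le_lt_trans (hN' _ (leq_maxr N _)); rewrite ler_pdivrMr // ler_peMr ?invr_ge0 ?ler0n //; lra.
exists y; split.
  move=> e e0; have [|m [h1 h2]] := sm (e / 2); first by rewrite divr_gt0.
  exists (v m); split; first by case: (hv m).
  by apply: le_lt_trans (nm_pair _) _; rewrite [e]splitr /= ltrD.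
apply/ler_addgt0Pl => e e0; have [|m [h1 h2]] := sm (e / 2); first by rewrite divr_gt0.
have := nmD (y - (v m).2) (v m).2; rewrite subrK.
have := nmD (f ((v m).1 - l)) (f l); rewrite -linearD subrK.
have := ctr ((v m).1 - l); rewrite (nmB (v m).1); have := cF _ _ (proj1 (hv m)); lra.
Qed.

Lemma make_linear (H1 H2 : rhilb R) (f : H1 -> H2) :
  (forall a x y, f (a *: x + y) = a *: f x + f y) -> exists g : {linear H1 -> H2}, g =1 f.
Proof.
move=> h; pose g := GRing.isLinear.Build R H1 H2 *:%R f h.
by exists (HB.pack_for {linear H1 -> H2} f g).
Qed.

(** The inverse of an isometry is a contractive relation on the range; its extension to the closure
    supplies a preimage of each adherent point. *)
Lemma image_closed (H1 H2 : rhilb R) (J : {linear H1 -> H2}) :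
  (forall x y, rip (J x) (J y) = rip x y) -> closedS (fun y => exists x, y = J x).
Proof.
move=> iJ l al; have nJ x : nm (J x) = nm x by rewrite /nm iJ.
have [| |y x ->||m [am _]] := @contractive_extension H2 H1 _ (fun y x => y = J x) idfun l.
- by [].
- by split=> /= [|a x y -> ->]; rewrite ?linear0 // linearP.
- by rewrite nJ.
- by [].
exists m; apply/eqP; rewrite -subr_eq0; apply/eqP/nm_small => e e0.
have [|[p q] /= [-> h]] := am (e / 2); first by rewrite divr_gt0.
have -> : l - J m = (l - J q) - J (m - q) by rewrite linearB opprB addrA subrK.
apply: le_trans (nmD _ _) _; rewrite nmN nJ [e]splitr; apply/ltW/ltrD.
  by apply: le_lt_trans h; exact: (nm_fst ((l, m) - (J q, q) : prodh H2 H1)).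
by apply: le_lt_trans h; exact: (nm_snd ((l, m) - (J q, q) : prodh H2 H1)).
Qed.

(** If q in V is orthogonal to W V, then <W q, W q> = <q, W W q> = 0, so q = 0. Here q is the
    component of x orthogonal to W V. *)
Lemma symmetric_dense_range (H : rhilb R) (W : {linear H -> H}) (V : H -> Prop) x :
  (forall x y, rip (W x) y = rip x (W y)) -> (forall x, W x = 0 -> x = 0) ->
  subsp V -> closedS V -> (forall x, V x -> V (W x)) -> V x ->
  adh (fun y => exists2 v, V v & y = W v) x.
Proof.
move=> sW iW sV cV WV Vx; pose U := fun y => exists2 v, V v & y = W v.
have [|p [ap op]] := @projection _ _ U x.
  split; first by exists 0; rewrite ?linear0 //; case: sV.
  by move=> a _ _ [u Vu ->] [v Vv ->]; exists (a *: u + v); rewrite ?linearP //; case: sV => _; exact.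
have Vp : V p by apply: cV => e /ap[_ [[v Vv ->] h]]; exists (W v); split=> //; exact: WV.
suff -> : x = p by [].
have Vq := subspB sV Vx Vp; apply/eqP; rewrite -subr_eq0; apply/eqP/iW/rip_def.
by rewrite sW; apply: op; exists (W (x - p)) => //; exact: WV.
Qed.
End Adherence.

(** * Resolvents of closed operators and normal operators *)

Section Resolvent.
Variables (R : realType) (H : rhilb R).
Implicit Types (T S : H -> H -> Prop) (C X : {linear H -> H}).

Definition adj T : H -> H -> Prop := fun y z => forall u v, T u v -> rip v y = rip u z.
Definition comp S T : H -> H -> Prop := fun x z => exists2 y, T x y & S y z.

(* [C = (1 + T^*T)^-1] and [X = T C]. *)
Definition resolvent T C X := forall x, T (C x) (X x) /\ adj T (X x) (x - C x).

Lemma adj_sub T : gsub (adj T).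
Proof.
split=> [u v _|a x y h1 h2 u v Tuv] /=; first by rewrite !rip0r.
by rewrite !ripE (h1 _ _ Tuv) (h2 _ _ Tuv).
Qed.

(** The adjoint relation is the orthogonal complement of the vectors (v, - u) with [T u v]. *)
Lemma adj_closed T : gclosed (adj T).
Proof.
move=> [y z] al u v Tuv /=; apply/eqP; rewrite -subr_eq0; apply/eqP.
have := @adh_orth R (prodh H H) _ _ (v, - u) al.
rewrite rip_pair /= ripNr (rip_sym v) (rip_sym u); apply=> -[y' z'] hyz.
by rewrite rip_pair /= ripNr (rip_sym v) (rip_sym u) (hyz _ _ Tuv) subrr.
Qed.

(** Subtracting two solutions of z + T^*T z = x gives |w - w'|^2 = - |z - z'|^2. *)
Lemma resolvent_unique T x z w z' w' : gsub T ->
  T z w -> adj T w (x - z) -> T z' w' -> adj T w' (x - z') -> z = z' /\ w = w'.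
Proof.
move=> sT Tz aw Tz' aw'; have Td := gsubB sT Tz Tz'.
have := (gsubB (adj_sub T) aw aw') _ _ Td; have -> : x - z - (x - z') = - (z - z').
  by rewrite !opprB addrC subrKA.
rewrite ripNr => h; have := rip_ge0 (z - z'); have := rip_ge0 (w - w').
by move=> p q; split; apply/eqP; rewrite -subr_eq0; apply/eqP/rip_def; lra.
Qed.

(** Von Neumann's argument: let (z, w) be the projection of (x, 0) on the closed graph.
    Orthogonality of (x - z, - w) to the graph says T^* w = x - z. *)
Lemma resolvent_exists T : gsub T -> gclosed T -> exists C X, resolvent T C X.
Proof.
move=> sT cT.
have /choice[f hf] x : exists p : H * H, T p.1 p.2 /\ adj T p.2 (x - p.1).
  have [[z w] [/cT Tp op]] := @projection R (prodh H H) _ (x, 0) sT.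
  exists (z, w); split=> // u v Tuv; have := op (u, v) Tuv.
  by rewrite rip_pair /= sub0r ripNl (rip_sym v) (rip_sym u) => ?; lra.
have lf a x y : (f (a *: x + y)).1 = a *: (f x).1 + (f y).1 /\
                (f (a *: x + y)).2 = a *: (f x).2 + (f y).2.
  have [? ?] := hf (a *: x + y); have [h1 h1'] := hf x; have [h2 h2'] := hf y.
  have h3 := gsubP a sT h1 h2; have h3' := gsubP a (adj_sub T) h1' h2'.
  apply: (@resolvent_unique T (a *: x + y)) => //; move: h3'.
  by rewrite scalerBr addrACA -opprD.
have [C hC] := make_linear (fun a x y => proj1 (lf a x y)).
have [X hX] := make_linear (fun a x y => proj2 (lf a x y)).
by exists C, X => x; rewrite hC hX.
Qed.

Section Facts.
Variables (T : H -> H -> Prop) (C X : {linear H -> H}).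
Hypotheses (sT : gsub T) (rT : resolvent T C X).

Lemma resolvent_eq z w a : T z w -> adj T w a -> z = C (z + a) /\ w = X (z + a).
Proof.
move=> h1 h2; have [h3 h4] := rT (z + a); apply: (resolvent_unique sT h1 _ h3 h4).
by rewrite addrC addKr.
Qed.

(** The identity C = X^*X + C^2 in weak form; symmetry, positivity and the bound C <= 1 follow from
    it. *)
Lemma resolvent_rip x y : rip (C x) y = rip (X x) (X y) + rip (C x) (C y).
Proof.
have [h1 h2] := rT x; have [h3 h4] := rT y.
by rewrite (h4 _ _ h1) ripBr subrK.
Qed.

Lemma resolvent_sym x y : rip (C x) y = rip x (C y).
Proof.
rewrite (resolvent_rip x y) (rip_sym (C y) x) (resolvent_rip y x).
by rewrite (rip_sym (X x)) (rip_sym (C x)).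
Qed.

Lemma resolvent_ge0 x : 0 <= rip (C x) x.
Proof. by rewrite resolvent_rip addr_ge0 ?rip_ge0. Qed.

Lemma resolvent_norm x : rip x x = rip (X x) (X x) + rip (C x) x + rip (x - C x) (x - C x).
Proof.
have := resolvent_rip x x; rewrite !ripE -(resolvent_sym x x); lra.
Qed.

Lemma resolvent_le1 x : rip (C x) x <= rip x x.
Proof.
by rewrite [leRHS]resolvent_norm; have := rip_ge0 (X x); have := rip_ge0 (x - C x); lra.
Qed.

Lemma resolvent_contraction : contraction X.
Proof.
move=> x; apply: nm_le; rewrite [leRHS]resolvent_norm.
by have := resolvent_ge0 x; have := rip_ge0 (x - C x); lra.
Qed.

Lemma resolvent_contractionC : contraction C.
Proof.
move=> x; apply: nm_le; apply: le_trans (resolvent_le1 x).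
by rewrite [leRHS]resolvent_rip lerDr rip_ge0.
Qed.

Lemma resolvent_inj x : functional T -> (forall y, adh (fun u => exists v, T u v) y) ->
  C x = 0 -> x = 0.
Proof.
move=> fT dT C0; have [h1 h2] := rT x.
have X0 : X x = 0 by apply: fT h1 _; rewrite C0; case: sT.
apply: rip_def; apply: adh_orth (dT x) _ => u [v Tuv].
by move: (h2 _ _ Tuv); rewrite X0 C0 subr0 rip0r.
Qed.

(* The part of [T] over [ran C] is dense in the graph of [T]: a graph vector
   [(z, Tz)] orthogonal to [(C g, X g)] satisfies [<z, g> = 0]. *)
Lemma resolvent_core (W : H -> Prop) x y :
  functional T -> gclosed T -> subsp W -> closedS W -> (forall x, W x -> W (C x)) ->
  W x -> T x y -> adh (fun p : prodh H H => exists2 g, W g & p = (C g, X g)) (x, y).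
Proof.
move=> fT cT sW cW CW Wx Txy.
pose V (p : prodh H H) := exists2 g, W g & p = (C g, X g).
have [|[p q] [ap op]] := @projection R (prodh H H) V (x, y).
  split; first by exists 0; rewrite ?linear0 //; case: sW.
  move=> a _ _ [g Wg ->] [g' Wg' ->]; exists (a *: g + g'); first by case: sW => _; exact.
  by rewrite !linearP.
have Tpq : T p q by apply: (cT (p, q)) => e /ap[_ [[g Wg ->] h]]; exists (C g, X g); split=> //; case: (rT g).
have Wp : W p.
  apply: cW => e /ap[_ [[g Wg ->] h]]; exists (C g); split; first exact: CW.
  by apply: le_lt_trans h; exact: (nm_fst ((p, q) - (C g, X g) : prodh H H)).
have Wq := subspB sW Wx Wp.
have p0 : x = p.
  apply/eqP; rewrite -subr_eq0; apply/eqP/rip_def.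
  have := op (C (x - p), X (x - p)) (ex_intro2 _ _ _ Wq erefl).
  rewrite rip_pair /=.
  have [_ /(_ _ _ (gsubB sT Txy Tpq)) ->] := rT (x - p).
  by rewrite -ripDr addrCA subrr addr0.
by move: Tpq ap; rewrite -p0 => Txq; rewrite -(fT _ _ _ Txy Txq).
Qed.
End Facts.
End Resolvent.

(** * Powers of relations and of normal operators *)

Fixpoint relpow (U : Type) (T : U -> U -> Prop) n : U -> U -> Prop :=
  if n is n'.+1 then fun x y => exists2 z, T x z & relpow T n' z y else fun x y => x = y.

Lemma relpow_rcons (U : Type) (T : U -> U -> Prop) n x y z :
  relpow T n x y -> T y z -> relpow T n.+1 x z.
Proof.
elim: n x => [|n IH] x /=; first by move=> <- Tz; exists z.
by move=> [w Tw h] Tz; exists w => //; exact: IH.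
Qed.

Lemma relpow_split (U : Type) (T : U -> U -> Prop) m n x z :
  relpow T (m + n) x z -> exists2 y, relpow T m x y & relpow T n y z.
Proof.
elim: m x => [|m IH] x /=; first by exists x.
by move=> [w Tw /IH[y h1 h2]]; exists y => //; exists w.
Qed.

Lemma relpow_cat (U : Type) (T : U -> U -> Prop) m n x y z :
  relpow T m x y -> relpow T n y z -> relpow T (m + n) x z.
Proof.
by elim: m x => [|m IH] x /=; [move=> ->|move=> [w Tw h1] h2; exists w => //; exact: IH].
Qed.

Lemma relpow_functional (U : Type) (T : U -> U -> Prop) n x y y' :
  (forall x y y', T x y -> T x y' -> y = y') -> relpow T n x y -> relpow T n x y' -> y = y'.
Proof.
move=> fT; elim: n x => [|n IH] x /=; first by move=> <-.
by move=> [z h1 h2] [z' h1' h2']; rewrite (fT _ _ _ h1' h1) in h2'; exact: IH h2'.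
Qed.

Section Normal.
Variables (R : realType) (K : rhilb R) (N : K -> K -> Prop) (C X : {linear K -> K}).
Hypotheses (sN : gsub N) (cN : gclosed N) (fN : functional N)
  (dN : forall y, adh (fun u => exists v, N u v) y)
  (nN : forall x z, comp (adj N) N x z <-> comp N (adj N) x z)
  (rN : resolvent N C X).

Lemma adj_functional : functional (adj N).
Proof.
move=> y z z' h h'; apply/eqP; rewrite -subr_eq0; apply/eqP/rip_def.
apply: adh_orth (dN _) _ => u [v Nuv].
by rewrite ripBr -(h _ _ Nuv) -(h' _ _ Nuv) subrr.
Qed.

(** N N^* X u = v - X u. Normality replaces N N^* by N^*N, so X u = C v, that is, N C u = C v. *)
Lemma normal_resolvent_comm u v : N u v -> N (C u) (C v).
Proof.
move=> Nuv; have [h1 h2] := rN u; have [|w N1 a1] := proj2 (nN (X u) (v - X u)).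
  by exists (u - C u) => //; exact: gsubB.
by have [e _] := resolvent_eq sN rN N1 a1; move: e h1; rewrite addrC subrK => <-.
Qed.

(** On the core, b = N^* C g satisfies |b|^2 = <C g, N N^* C g> = <C g, N^*N C g> = |N C g|^2. The
    bound extends to the whole graph of N, compared through the second projection, and N^* is
    closed. *)
Lemma normal_dom_adj u v : N u v -> exists2 w, adj N u w & nm w <= nm v.
Proof.
move=> Nuv.
pose F (p : prodh K K) b := exists2 g, p = (C g, X g) & adj N (C g) b /\ N b (g - C g).
have Fnm p b : F p b -> nm b <= nm p.2.
  move=> [g -> [h1 h2]]; apply: nm_le; have [h3 h4] := rN g.
  by rewrite -(h1 _ _ h2) (h4 _ _ h3) rip_sym.
have [| | p b /Fnm // | |w [aw le]] := @contractive_extension R _ _ K F snd (u, v).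
- exact: nm_snd.
- split=> [|a p q [g e [h1 h2]] [g' e' [h1' h2']]].
    by exists 0; rewrite !linear0 ?addr0; split; [exact: (proj1 (adj_sub N))|exact: (proj1 sN)].
  exists (a *: g + g'); first by rewrite [LHS]surjective_pairing /= e e' !linearP.
  rewrite (linearP C); split; first exact: gsubP (adj_sub N) h1 h1'.
  by have := gsubP a sN h2 h2'; rewrite scalerBr addrACA -opprD.
- have al := @resolvent_core _ _ _ _ _ sN rN (fun _ => True) u v fN cN.
  move=> e e0; have [|//|//|//|//|_ [[g _ ->] lt]] := al _ _ _ _ _ e e0; first by split.
  exists (C g, X g); split=> //; have [h1 h2] := rN g.
  have [|w a1 N1] := proj1 (nN (C g) (g - C g)); first by exists (X g).
  by exists w; exists g.
exists w; last exact: le.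
apply: (@adj_closed _ _ N (u, w)) => e e0; have [[[p q] b] [/= [g [-> ->] [h1 _]] lt]] := aw e e0.
exists (C g, b); split=> //; apply: le_lt_trans lt.
rewrite /= /nm !rip_pair ler_sqrt ?addr_ge0 ?rip_ge0 //=.
by have := rip_ge0 (v - X g); lra.
Qed.

Definition absq : K -> K -> Prop := comp (adj N) N.

Lemma absq_functional : functional absq.
Proof.
move=> x z z' [y N1 a1] [y' N2 a2]; rewrite (fN N1 N2) in a1.
exact: adj_functional a1 a2.
Qed.

Lemma absq_exists u v w : N u v -> N v w -> exists2 z, absq u z & nm z <= nm w.
Proof. by move=> h /normal_dom_adj[z az le]; exists z => //; exists v. Qed.

(** Translates the unbounded N^*N into the bounded C, so that powers of N^*N can be compared by
    polynomials in C. *)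
Lemma absq_resolvent u z : absq u z -> C z = u - C u.
Proof.
move=> [y N1 a1]; have [e _] := resolvent_eq sN rN N1 a1.
by rewrite {1}e linearD addrC addKr.
Qed.

Lemma absq_intertwine u z v z' : absq u z -> N u v -> absq v z' -> N z z'.
Proof.
move=> [v' N1 a1] N2 /nN[w a2 N3].
by rewrite -(fN N2 N1) in a1; rewrite (adj_functional a1 a2).
Qed.


(** Trades two factors N for one N^*N, which is moved through N^m one factor at a time by
    [absq_intertwine]. *)
Lemma absq_relpow m x y : relpow N m.+2 x y ->
  exists z q xm, [/\ absq x z, relpow N m z q, relpow N m x xm, absq xm q & nm q <= nm y].
Proof.
elim: m x => [|m IH] x.
  by move=> [v h1 [w h2 <-]]; have [z az le] := absq_exists h1 h2; exists z, z, x.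
move=> [v h1 hv]; have [z1 [q [xm [a1 r1 r2 a2 le]]]] := IH v hv.
have [w h2 _] := hv; have [z az _] := absq_exists h1 h2.
exists z, q, xm; split=> //; last by exists v.
by exists z1 => //; exact: absq_intertwine az h1 a1.
Qed.

(* [b = (N^*N)^n x]; the inequality [|b| <= |N^(2n) x|] is the only norm information needed. *)
Lemma absq_power n x y : relpow N (n + n) x y ->
  exists b, [/\ iter n C b = iter n (fun u => u - C u) x, nm b <= nm y &
    exists2 xn, relpow N n x xn & forall g gn, relpow N n g gn -> rip b g = rip xn gn].
Proof.
elim: n x y => [|n IH] x y; first by move=> /= ->; exists y; split=> //; exists y => // g _ <-.
rewrite addSn addnS => hx; have [z [q [xm [az zq _ _ le]]]] := absq_relpow hx.
have [b [h1 h2 [zn r1 h3]]] := IH z q zq; exists b; split; last 1 first.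
(* The first n+2 factors show N^n z = N^* N^(n+1) x; this last N^* is moved to the other side of the
   inner product, where it becomes the missing factor N on g. *)
- have [y' hy' _] := @relpow_split _ _ n.+2 n _ _ hx.
  have [z' [q' [xn [az' zq' rx axn _]]]] := absq_relpow hy'.
  have ez := absq_functional az' az; rewrite {}ez in zq'.
  have eq := relpow_functional fN zq' r1; rewrite {}eq in axn.
  have [xn1 N1 a1] := axn; exists xn1; first exact: relpow_rcons rx N1.
  move=> g gn; rewrite -addn1 => hgn; have [g' hg [w N2 ew]] := relpow_split hgn; rewrite {}ew in N2.
  by rewrite (h3 _ _ hg) rip_sym -(a1 _ _ N2) rip_sym.
- rewrite iterS h1 iterSr -(absq_resolvent az).
  by elim: (n) => //= k <-; rewrite linearB.
- exact: le_trans le.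
Qed.
End Normal.

(** * Polynomials in a positive contraction and roots *)

Section Evaluation.
Variables (R : realType) (H : rhilb R) (C : {linear H -> H}).
Implicit Types (p q : {poly R}) (x y : H).

Definition ev p x : H := \sum_(i < size p) p`_i *: iter i C x.

Lemma ev_widen n p x : (size p <= n)%N -> ev p x = \sum_(i < n) p`_i *: iter i C x.
Proof.
move=> le; rewrite /ev (big_ord_widen n (fun i => p`_i *: iter i C x) le).
rewrite big_mkcond; apply: eq_bigr => i _; case: ltnP => // h.
by rewrite nth_default // scale0r.
Qed.

Lemma iter_linearP n a x y : iter n C (a *: x + y) = a *: iter n C x + iter n C y.
Proof. by elim: n => //= n ->; rewrite linearP. Qed.

Lemma ev_linear p : linear (ev p).
Proof.
move=> a x y; rewrite /ev scaler_sumr -big_split /=; apply: eq_bigr => i _.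
by rewrite iter_linearP scalerDr !scalerA [_ * a]mulrC.
Qed.
HB.instance Definition _ p := GRing.isLinear.Build R H H *:%R (ev p) (ev_linear p).

Lemma evD p q x : ev (p + q) x = ev p x + ev q x.
Proof.
pose n := maxn (size p) (size q).
rewrite (@ev_widen n (p + q)) ?size_polyD // (@ev_widen n p) ?leq_maxl // (@ev_widen n q) ?leq_maxr //.
by rewrite -big_split; apply: eq_bigr => i _; rewrite coefD scalerDl.
Qed.
Lemma evC a x : ev a%:P x = a *: x.
Proof.
by rewrite (@ev_widen 1) ?size_polyC ?leq_b1 // big_ord1 coefC.
Qed.
Lemma evXM p x : ev (p * 'X) x = C (ev p x).
Proof.
rewrite (@ev_widen (size p).+1); last first.
  by apply: leq_trans (size_polyMleq _ _) _; rewrite size_polyX addn2.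
rewrite big_ord_recl coefMX eqxx scale0r add0r [ev p x]/ev raddf_sum.
by apply: eq_bigr => i _; rewrite coefMX /= linearZ.
Qed.
Lemma evX x : ev 'X x = C x.
Proof. by rewrite -[X in ev X](mul1r 'X) evXM -[1]/(1%:P) evC scale1r. Qed.
Lemma evM p q x : ev (p * q) x = ev p (ev q x).
Proof.
elim/poly_ind: p => [|p c IH]; first by rewrite mul0r -[0]/(0%:P) !evC !scale0r.
rewrite mulrDl evD evD -mulrA (mulrC 'X) mulrA !evXM IH; congr (_ + _).
elim/poly_ind: q {IH} => [|q d IH]; first by rewrite mulr0 -[0]/(0%:P) !evC scale0r scaler0.
by rewrite mulrDr mulrA !evD !evXM IH -polyCM !evC linearZ /= scalerDr scalerA.
Qed.
Lemma evN p x : ev (- p) x = - ev p x.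
Proof. by rewrite -mulN1r -polyCN evM evC scaleN1r. Qed.
Lemma evB p q x : ev (p - q) x = ev p x - ev q x.
Proof. by rewrite evD evN. Qed.
Lemma ev1 x : ev 1 x = x.
Proof. by rewrite -[1]/(1%:P) evC scale1r. Qed.
Lemma ev0 x : ev 0 x = 0.
Proof. by rewrite -[0]/(0%:P) evC scale0r. Qed.
Lemma ev_comm p q x : ev p (ev q x) = ev q (ev p x).
Proof. by rewrite -!evM mulrC. Qed.
Lemma ev_exp p n x : ev (p ^+ n) x = iter n (ev p) x.
Proof. by elim: n => [|n IH]; rewrite ?expr0 ?ev1 // exprS evM IH. Qed.

Hypothesis symC : forall x y, rip (C x) y = rip x (C y).

Lemma ev_sym p x y : rip (ev p x) y = rip x (ev p y).
Proof.
elim/poly_ind: p x y => [|p c IH] x y; first by rewrite !ev0 rip0l rip0r.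
rewrite !evD !evXM !evC !ripE symC IH; congr (rip x _ + _).
by rewrite -[C y]evX ev_comm evX.
Qed.
End Evaluation.

(** * Algebraic certificates of positivity on the unit interval *)

Section Cone.
Variable R : realType.
Implicit Types (p q : {poly R}).

(** Every member is visibly nonnegative on [0, 1]. Inequalities for an operator 0 <= G <= 1 are read
    off from membership, so no spectral theorem enters. *)
Inductive pcone : {poly R} -> Prop :=
| pcone_gen q i j : pcone (q ^+ 2 * 'X^i * (1 - 'X) ^+ j)
| pcone_add p q : pcone p -> pcone q -> pcone (p + q).

Lemma pcone_sq q : pcone (q ^+ 2).
Proof. by rewrite -[q ^+ 2]mulr1 -[q ^+ 2 * 1]mulr1; exact: (pcone_gen q 0 0). Qed.
Lemma pcone_polyC a : 0 <= a -> pcone a%:P.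
Proof. by move=> a0; rewrite -(sqr_sqrtr a0) rmorphXn; exact: pcone_sq. Qed.
Lemma pcone0 : pcone 0. Proof. exact: pcone_polyC. Qed.
Lemma pcone1 : pcone 1. Proof. exact: (pcone_polyC ler01). Qed.
Lemma pconeX : pcone 'X.
Proof. by have := pcone_gen 1 1 0; rewrite expr1n mul1r mulr1 expr1. Qed.
Lemma pcone1X : pcone (1 - 'X).
Proof. by have := pcone_gen 1 0 1; rewrite expr1n !mul1r expr1. Qed.
Lemma pconeM p q : pcone p -> pcone q -> pcone (p * q).
Proof.
move=> hp hq; elim: hp => [f i j|p1 p2 _ h1 _ h2]; last by rewrite mulrDl; exact: pcone_add.
elim: hq => [g k l|q1 q2 _ h1 _ h2]; last by rewrite mulrDr; exact: pcone_add.
have := pcone_gen (f * g) (i + k) (j + l); rewrite exprMn !exprD.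
by rewrite (_ : _ * _ * _ * _ = f ^+ 2 * 'X^i * (1 - 'X) ^+ j * (g ^+ 2 * 'X^k * (1 - 'X) ^+ l)) //; ring.
Qed.
Lemma pcone_exp p n : pcone p -> pcone (p ^+ n).
Proof. by move=> hp; elim: n => [|n IH]; [exact: pcone1|rewrite exprS; exact: pconeM]. Qed.
Lemma pcone_sum n (F : 'I_n -> {poly R}) : (forall i, pcone (F i)) -> pcone (\sum_(i < n) F i).
Proof. by move=> h; elim/big_ind: _ => //; [exact: pcone0|exact: pcone_add]. Qed.
Lemma pcone_subM p q : pcone p -> pcone (1 - p) -> pcone (1 - q) -> pcone (1 - p * q).
Proof.
move=> hp hp1 hq1; have -> : 1 - p * q = 1 - p + p * (1 - q) by ring.
by apply: pcone_add => //; exact: pconeM.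
Qed.
Lemma pcone_subX p n : pcone p -> pcone (1 - p) -> pcone (1 - p ^+ n).
Proof.
move=> hp hp1; elim: n => [|n IH]; first by rewrite subrr; exact: pcone0.
by rewrite exprS; exact: pcone_subM.
Qed.
Lemma pcone_powB p q n : pcone p -> pcone q -> pcone (p - q) -> pcone (p ^+ n - q ^+ n).
Proof.
move=> hp hq hpq; rewrite subrXX; apply: pconeM => //; apply: pcone_sum => i.
by apply: pconeM; exact: pcone_exp.
Qed.

Variables (H : rhilb R) (G : {linear H -> H}).
Hypotheses (symG : forall x y, rip (G x) y = rip x (G y))
  (G_ge0 : forall x, 0 <= rip (G x) x) (G_le1 : forall x, rip (G x) x <= rip x x).

(** Squares are absorbed into the vector by symmetry, so only exponents modulo 2 remain; the mixed
    case is X (1 - X) = X^2 (1 - X) + (1 - X)^2 X. *)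
Lemma pcone_ge0 p x : pcone p -> 0 <= rip (ev G p x) x.
Proof.
have sq f g y : rip (ev G (f ^+ 2 * g) y) y = rip (ev G g (ev G f y)) (ev G f y).
  by rewrite expr2 -mulrA evM (ev_sym symG) (mulrC f) evM.
have X0 y : 0 <= rip (ev G 'X y) y by rewrite evX.
have X1 y : 0 <= rip (ev G (1 - 'X) y) y by rewrite evB ev1 evX ripBl subr_ge0.
have XX y : 0 <= rip (ev G ('X * (1 - 'X)) y) y.
  have -> : 'X * (1 - 'X) = 'X ^+ 2 * (1 - 'X) + (1 - 'X) ^+ 2 * 'X :> {poly R} by ring.
  by rewrite evD ripDl addr_ge0 // sq.
elim=> {p} [q i j|p q _ hp _ hq]; last by rewrite evD ripDl addr_ge0.
rewrite -(odd_double_half i) -(odd_double_half j) -!muln2 !exprD !exprM.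
have -> : q ^+ 2 * ('X^(odd i) * ('X^(i./2)) ^+ 2) * ((1 - 'X) ^+ odd j * ((1 - 'X) ^+ j./2) ^+ 2)
  = (q * 'X^(i./2) * (1 - 'X) ^+ j./2) ^+ 2 * ('X^(odd i) * (1 - 'X) ^+ odd j) by ring.
rewrite sq; move: (ev G _ x) => y.
by case: (odd i); case: (odd j); rewrite ?expr0 ?expr1 ?mul1r ?mulr1 ?ev1 ?rip_ge0.
Qed.

Lemma pcone_le p q x : pcone (q - p) -> rip (ev G p x) x <= rip (ev G q x) x.
Proof. by move=> h; rewrite -subr_ge0 -ripBl -evB pcone_ge0. Qed.

(** X - X^2 = X (1 - X) lies in the cone, so |G x|^2 <= <G x, x> <= |x|^2. *)
Lemma cone_contraction : contraction G.
Proof.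
move=> x; apply: nm_le; apply: le_trans (G_le1 x).
have -> : rip (G x) (G x) = rip (ev G ('X * 'X) x) x by rewrite evM !evX symG (rip_sym x).
rewrite -evX; apply: pcone_le; rewrite -{1}['X]mulr1 -mulrBr.
by apply: pconeM; [exact: pconeX|exact: pcone1X].
Qed.
End Cone.

(** * Polynomial approximation of positive roots *)

Section Root.
Variables (R : realType) (n : nat).

(* Polynomial iteration for the [n.+1]-st root: [rootp k] evaluated at [x] is a polynomial in
   [x ^+ n.+1] which increases to [x] on [0, 1]. *)
Fixpoint rootp (k : nat) : {poly R} :=
  if k is k'.+1 then rootp k' + (n.+1%:R^-1)%:P * ('X ^+ n.+1 - rootp k' ^+ n.+1) else 0.
Let e k := 'X - rootp k.
Let c := (n.+1%:R^-1)%:P : {poly R}.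

Let c_cone : pcone c.
Proof. by apply: pcone_polyC; rewrite invr_ge0 ler0n. Qed.

(** The cofactor of X - r in X^(n+1) - r^(n+1), for r the k-th approximation; its term i = 0 is
    X^n. *)
Let Sg k := \sum_(i < n.+1) 'X^(n.+1.-1 - i) * rootp k ^+ i.

Let e_step k : e k.+1 = e k * (1 - c * Sg k).
Proof. by rewrite /e /= subrXX -/(Sg k) -/c; ring. Qed.

Lemma rootp_cone k : [/\ pcone (rootp k), pcone ('X - rootp k) & pcone (1 - rootp k)].
Proof.
suff [h1 h2] : pcone (rootp k) /\ pcone ('X - rootp k).
  split=> //; have -> : 1 - rootp k = (1 - 'X) + ('X - rootp k) by ring.
  by apply: pcone_add => //; exact: pcone1X.
elim: k => [|k [h1 h2]]; first by rewrite subr0; split; [exact: pcone0|exact: pconeX].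
have h3 : pcone (1 - rootp k).
  have -> : 1 - rootp k = (1 - 'X) + ('X - rootp k) by ring.
  by apply: pcone_add => //; exact: pcone1X.
split.
  apply: pcone_add => //; apply: pconeM => //; apply: pcone_powB => //; exact: pconeX.
rewrite -/(e k.+1) e_step; apply: pconeM => //.
(* As c = 1/(n+1), the factor 1 - c Sg is the mean of the polynomials 1 - X^(n-i) r^i, each in the
   cone. *)
have -> : 1 - c * Sg k = c * \sum_(i < n.+1) (1 - 'X^(n.+1.-1 - i) * rootp k ^+ i).
  rewrite sumrB mulrBr -/(Sg k) sumr_const card_ord -[1 *+ n.+1]/(n.+1%:R) -[n.+1%:R](rmorph_nat polyC).
  by rewrite -polyCM mulVf ?pnatr_eq0.
apply: pconeM => //; apply: pcone_sum => i; apply: pcone_subM.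
- exact/pcone_exp/pconeX.
- by apply: pcone_subX; [exact: pconeX|exact: pcone1X].
- exact: pcone_subX.
Qed.

Let e_cone k : pcone (e k). Proof. by case: (rootp_cone k). Qed.
Let ec_cone k : pcone (1 - e k).
Proof.
have [h _ _] := rootp_cone k; have -> : 1 - e k = (1 - 'X) + rootp k by rewrite /e; ring.
by apply: pcone_add => //; exact: pcone1X.
Qed.

(** The drop equals c e Sg, and Sg dominates X^n, which dominates e^n. *)
Let e_drop k : pcone (e k - e k.+1 - c * e k ^+ n.+1).
Proof.
have [h1 h2 _] := rootp_cone k.
have -> : e k - e k.+1 - c * e k ^+ n.+1 = c * (e k * (Sg k - e k ^+ n)).
  by rewrite e_step exprS; ring.
apply: pconeM => //; apply: pconeM => //.
rewrite /Sg big_ord_recl expr0 mulr1 subn0 addrAC; apply: pcone_add.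
  apply: pcone_powB => //; first exact: pconeX.
  by rewrite /e subKr.
apply: pcone_sum => i; apply: pconeM; apply: pcone_exp => //; exact: pconeX.
Qed.

(** Since e decreases, k c e_k^(n+1) is at most the sum of the first k drops, which is X - e_k.
    Hence e_k^(n+1) is of order 1/k. *)
Lemma rootp_error k : pcone ('X - (k%:R / n.+1%:R)%:P * ('X - rootp k) ^+ n.+1).
Proof.
suff h : pcone ('X - e k - (k%:R / n.+1%:R)%:P * e k ^+ n.+1).
  rewrite (_ : _ - _ = e k + ('X - e k - (k%:R / n.+1%:R)%:P * e k ^+ n.+1)); last by rewrite /e; ring.
  exact: pcone_add.
elim: k => [|k IH]; first by rewrite mul0r polyC0 mul0r /e /= !subr0 subrr; exact: pcone0.
have -> : (k.+1%:R / n.+1%:R)%:P = (k%:R / n.+1%:R)%:P + c.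
  by rewrite -polyCD -[k.+1%:R]natr1 mulrDl mul1r.
have -> : 'X - e k.+1 - ((k%:R / n.+1%:R)%:P + c) * e k.+1 ^+ n.+1 =
  ('X - e k - (k%:R / n.+1%:R)%:P * e k ^+ n.+1) + (e k - e k.+1 - c * e k ^+ n.+1)
  + ((k%:R / n.+1%:R)%:P + c) * (e k ^+ n.+1 - e k.+1 ^+ n.+1) by ring.
apply: pcone_add; first exact: pcone_add.
apply: pconeM; first by apply: pcone_add => //; apply: pcone_polyC; rewrite divr_ge0 ?ler0n.
apply: pcone_powB => //.
have -> : e k - e k.+1 = (e k - e k.+1 - c * e k ^+ n.+1) + c * e k ^+ n.+1 by ring.
by apply: pcone_add => //; apply: pconeM => //; exact: pcone_exp.
Qed.

Variables (H : rhilb R) (G : {linear H -> H}) (V : H -> Prop).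
Hypotheses (symG : forall x y, rip (G x) y = rip x (G y))
  (G_ge0 : forall x, 0 <= rip (G x) x) (G_le1 : forall x, rip (G x) x <= rip x x)
  (sV : subsp V) (cV : closedS V) (GV : forall x, V x -> V (iter n.+1 G x)).

Lemma rootp_stable k x : V x -> V (ev G (rootp k) x).
Proof.
elim: k x => [|k IH] x Vx; first by rewrite ev0; case: sV.
have Vn m y : V y -> V (iter m (ev G (rootp k)) y) by move=> Vy; elim: m => //= m; exact: IH.
rewrite /= evD evM evC evB; apply: subspD => //; first exact: IH.
apply: subspZ => //; apply: subspB => //; last by rewrite ev_exp; exact: Vn.
by rewrite ev_exp (eq_iter (evX G)); exact: GV.
Qed.

(** [rootp k] at G maps V into V, being built from G^(n+1), and tends strongly to G: <e_k^(n+1) x,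
    x> becomes small, and Cauchy-Schwarz carries this over to |e_k x|. *)
Lemma root_stable x : V x -> V (G x).
Proof.
move=> Vx; apply: cV.
have small d : 0 < d -> exists k, rip (ev G (e k ^+ n.+1) x) x < d.
  move=> d0; have xx1 : 0 < (rip x x + 1) * n.+1%:R / d.
    by rewrite divr_gt0 // mulr_gt0 ?ltr0n // ltr_wpDl ?rip_ge0.
  pose k := Num.bound ((rip x x + 1) * n.+1%:R / d); exists k.
  have := archi_boundP (ltW xx1); rewrite -/k ltr_pdivrMr // => hk.
  have := pcone_le symG G_ge0 G_le1 x (rootp_error k); rewrite -/(e k) evM evC evX ripZl => h.
  have k0 : 0 < k%:R / n.+1%:R :> R.
    rewrite divr_gt0 ?ltr0n // lt0n; apply/eqP => k0; move: hk; rewrite k0 mul0r.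
  have h' := le_trans h (G_le1 x); rewrite -(ltr_pM2l k0); apply: le_lt_trans h' _.
  rewrite mulrAC ltr_pdivlMr ?ltr0n //; apply: lt_trans hk.
  by rewrite ltr_pM2r ?ltr0n // ltrDl.
(* The exponent halves from 2^(n+1), which is at least n+1, down to 2 at j = n, by <e^m x, x> <=
   |e^m x| |x| and |e^m x|^2 = <e^(2m) x, x>. *)
have pw j d : 0 < d -> exists k, rip (ev G (e k ^+ (2 ^ (n.+1 - j))) x) x < d.
  elim: j d => [|j IH] d d0.
    have [k hk] := small d d0; exists k; apply: le_lt_trans hk; apply: pcone_le => //.
    have /subnKC <- : (n.+1 <= 2 ^ (n.+1 - 0))%N by rewrite subn0 ltnW // ltn_expl.
    rewrite exprD -{1}[_ ^+ _]mulr1 -mulrBr; apply: pconeM; first exact: pcone_exp.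
    exact: pcone_subX.
  (* For j > n truncated subtraction makes both exponents 2^0. *)
  have [le|lt] := leqP n.+1 j.
    have := IH d d0; have /eqP-> : (n.+1 - j == 0)%N by rewrite subn_eq0.
    by have /eqP-> : (n.+1 - j.+1 == 0)%N by rewrite subn_eq0 leqW.
  have nx : 0 < nm x + 1 by have := nm_ge0 x; lra.
  have [|k hk] := IH ((d / (nm x + 1)) ^+ 2); first by rewrite exprn_gt0 // divr_gt0.
  exists k; set m := (2 ^ (n.+1 - j.+1))%N.
  have em : (2 ^ (n.+1 - j))%N = (m + m)%N by rewrite /m -(subnSK lt) expnS mul2n addnn.
  apply: le_lt_trans (cauchy_schwarz _ _) _; move: hk.
  rewrite em exprD evM (ev_sym symG) -nm_sq ltr_pXn2r ?nnegrE ?nm_ge0 //; last by rewrite ltW // divr_gt0.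
  rewrite ltr_pdivlMr // => hk; apply: le_lt_trans hk.
  by rewrite ler_wpM2l ?nm_ge0 //; lra.
move=> d d0; have [k hk] := pw n (d ^+ 2) (exprn_gt0 _ d0).
exists (ev G (rootp k) x); split; first exact: rootp_stable.
move: hk; rewrite subSnn expn1 expr2 evM (ev_sym symG) -nm_sq.
by rewrite ltr_pXn2r ?nnegrE ?nm_ge0 // ?ltW // evB evX.
Qed.
End Root.

(** * Stability of a subspace under the resolvent *)

Section Coercive.
Variables (R : realType) (H : rhilb R) (E : {linear H -> H}) (d : R).
Hypotheses (symE : forall x y, rip (E x) y = rip x (E y))
  (d0 : 0 < d) (coE : forall x, d * rip x x <= rip (E x) x).

Lemma coercive_inj x : E x = 0 -> x = 0.
Proof.
move=> E0; apply: rip_def; apply/le_anti; rewrite rip_ge0 andbT.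
by rewrite -(pmulr_rle0 _ d0); apply: le_trans (coE x) _; rewrite E0 rip0l.
Qed.

Lemma coercive_lower x : nm (d *: x) <= nm (E x).
Proof.
rewrite nmZ gtr0_norm //; have [x0|x0] := eqVneq (nm x) 0; first by rewrite x0 mulr0 nm_ge0.
have xp : 0 < nm x by rewrite lt_def x0 nm_ge0.
rewrite -(ler_pM2r xp) -mulrA -expr2 nm_sq.
exact: le_trans (coE x) (cauchy_schwarz _ _).
Qed.

(** Lax-Milgram for symmetric E: the range is dense, and E x -> d x is contractive on it, so it
    extends to y with a value m satisfying E m = d y. *)
Lemma coercive_surj y : exists x, E x = y.
Proof.
have al : adh (fun u => exists v, exists2 x, u = E x & v = d *: x) y.
  have h := @symmetric_dense_range _ _ E (fun _ => True) y symE coercive_inj.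
  move=> e e0; have [|//|//|//|_ [[x _ ->] lt]] := h _ _ _ _ e e0; first by split.
  by exists (E x); split=> //; exists (d *: x), x.
have [| | |m [am _]] := contractive_extension (f := idfun) _ _ _ al.
- by [].
- split=> [|a p q [x e e'] [z f f']]; first by exists 0; rewrite ?linear0 ?scaler0.
  exists (a *: x + z); rewrite /= ?e ?e' ?f ?f' ?linearP //.
- by move=> _ _ [x -> ->]; exact: coercive_lower.
exists (d^-1 *: m); rewrite linearZ /=.
suff -> : E m = d *: y by rewrite scalerA mulVf ?scale1r // gt_eqF.
(* By symmetry (d w, - E w) is orthogonal to every pair (E x, d x), hence to their limit (y, m). *)
have key w : rip (d *: y - E m) w = 0.
  have := @adh_orth R (prodh H H) _ _ (d *: w, - E w) am.
  rewrite rip_pair /= !ripE -symE; apply=> -[u v] [x /= -> ->].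
  by rewrite rip_pair /= !ripE -symE subrr.
by apply/eqP; rewrite eq_sym -subr_eq0; apply/eqP/rip_def/key.
Qed.
End Coercive.

(** * From the resolvent of a power back to the resolvent *)

Section PowerRatio.
Variables (R : realType) (K : rhilb R) (C : {linear K -> K}) (n : nat).
Hypotheses (symC : forall x y, rip (C x) y = rip x (C y))
  (C_ge0 : forall x, 0 <= rip (C x) x) (C_le1 : forall x, rip (C x) x <= rip x x)
  (C_inj : forall x, C x = 0 -> x = 0).

(** At C = (1 + N^*N)^-1 this is formally C^m (1 + (N^*N)^m). *)
Definition powsum m : {poly R} := 'X ^+ m + (1 - 'X) ^+ m.
Let d : R := 2^-1 ^+ n.

Let d_gt0 : 0 < d. Proof. by rewrite exprn_gt0 // invr_gt0. Qed.

(** 2^-m is the minimum of X^(m+1) + (1 - X)^(m+1) on [0, 1], attained at 1/2. *)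
Lemma powsum_lower m : pcone (powsum m.+1 - (2^-1 ^+ m)%:P : {poly R}).
Proof.
elim: m => [|m IH].
  by rewrite /powsum !expr1 expr0 [X in X - _]addrC subrK subrr; exact: pcone0.
set h : {poly R} := (2^-1)%:P; have h2 : h + h = 1 by rewrite -polyCD -[X in X + _]mul1r -[X in _ + X]mul1r -splitr.
rewrite exprS polyCM -/h; set D := (2^-1 ^+ m)%:P in IH *.
(* With a = X and b = 1 - X, twice a^(m+2) + b^(m+2) is (a^(m+1) + b^(m+1)) (a + b) + (a^(m+1) -
   b^(m+1)) (a - b); the last product is (a - b)^2 times a member of the cone. *)
have -> : powsum m.+2 - h * D = h * (powsum m.+1 - D)
    + h * (('X ^+ m.+1 - (1 - 'X) ^+ m.+1) * ('X - (1 - 'X))).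
  have -> : powsum m.+2 = (h + h) * powsum m.+2 by rewrite h2 mul1r.
  by rewrite /powsum !exprS; ring.
have hc : pcone h by apply: pcone_polyC; rewrite invr_ge0.
apply: pcone_add; apply: pconeM => //.
rewrite subrXX mulrAC -expr2; apply: pconeM; first exact: pcone_sq.
by apply: pcone_sum => i; apply: pconeM; apply: pcone_exp; [exact: pconeX|exact: pcone1X].
Qed.

Let E : {linear K -> K} := ev C (powsum n.+1).

Let E_comm p x : E (ev C p x) = ev C p (E x). Proof. exact: ev_comm. Qed.
Let E_sym x y : rip (E x) y = rip x (E y). Proof. exact: ev_sym. Qed.
Let E_coercive x : d * rip x x <= rip (E x) x.
Proof. by rewrite -ripZl -(evC C); apply: pcone_le => //; exact: powsum_lower. Qed.

Lemma powsum_inj x : ev C (powsum n.+1) x = 0 -> x = 0.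
Proof. exact: (coercive_inj d_gt0 E_coercive). Qed.

(* With [N^*N = C^-1 - 1] and [Y = (1 + (N^*N)^n.+1)^-1 = C^n.+1 / powsum], the operator
   [G = N^*N Y] satisfies [G^n.+1 = (1 - Y) Y^n], so that a subspace stable under [Y] is stable
   under [G] by [root_stable]; finally [C (Y + G) = Y]. *)
Lemma power_ratio_stable (V : K -> Prop) x : subsp V -> closedS V ->
  (forall x, V x -> exists2 y, V y & ev C (powsum n.+1) y = ev C ('X ^+ n.+1) x) ->
  V x -> V (C x).
Proof.
move=> sV cV VY Vx.
(* Q inverts E, so that Y = Q C^(n+1) and 1 - Y = Q (1 - C)^(n+1); both preserve V. *)
have /choice[q hq] := coercive_surj E_sym d_gt0 E_coercive.
have Einj u v : E u = E v -> u = v.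
  by move=> h; apply/eqP; rewrite -subr_eq0; apply/eqP/powsum_inj; rewrite linearB [X in X - _]h subrr.
have [Q hQ] : exists Q : {linear K -> K}, Q =1 q.
  by apply: make_linear => a u v; apply: Einj; rewrite linearP !hq.
have EQ u : E (Q u) = u by rewrite hQ hq.
have Qev p u : Q (ev C p u) = ev C p (Q u) by apply: Einj; rewrite E_comm !EQ.
have QE u : Q (E u) = u by apply: Einj; rewrite EQ.
have VYQ u : V u -> V (Q (ev C ('X ^+ n.+1) u)).
  by move=> /VY[y Vy <-]; rewrite QE.
have VZQ u : V u -> V (Q (ev C ((1 - 'X) ^+ n.+1) u)).
  move=> Vu; have -> : Q (ev C ((1 - 'X) ^+ n.+1) u) = u - Q (ev C ('X ^+ n.+1) u).
    apply/(canRL (addrK _)); rewrite -linearD -evD addrC; exact: QE.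
  by apply: subspB => //; exact: VYQ.
(* The factor d makes [G], which is d times N^*N Y, at most 1, since E >= d. *)
pose k : {poly R} := d%:P * (1 - 'X) * 'X ^+ n.
pose G : {linear K -> K} := ev C k \o Q.
have Gq u v : rip (G (E u)) (E v) = rip (ev C (powsum n.+1 * k) u) v.
  by rewrite /G /= QE -E_sym evM.
have kc : pcone k.
  by apply: pconeM; [apply: pconeM; [exact/pcone_polyC/ltW|exact: pcone1X]|exact/pcone_exp/pconeX].
have Ec : pcone (powsum n.+1) by apply: pcone_add; apply: pcone_exp; [exact: pconeX|exact: pcone1X].
have Gsym u v : rip (G u) v = rip u (G v).
  by rewrite -(EQ u) -(EQ v) Gq (rip_sym (G _)) Gq ev_sym // rip_sym.
have G0 u : 0 <= rip (G u) u by rewrite -(EQ u) Gq pcone_ge0 //; exact: pconeM.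
have G1 u : rip (G u) u <= rip u u.
  have -> : rip u u = rip (ev C (powsum n.+1 * powsum n.+1) (Q u)) (Q u).
    by rewrite -{1 2}(EQ u) -E_sym evM.
  rewrite -{1 2}(EQ u) Gq; apply: pcone_le => //.
  rewrite -mulrBr; apply: pconeM => //.
  have -> : powsum n.+1 - k = (powsum n.+1 - d%:P) + d%:P * (1 - (1 - 'X) * 'X ^+ n) by rewrite /k; ring.
  apply: pcone_add; first exact: powsum_lower.
  apply: pconeM; first exact/pcone_polyC/ltW.
  apply: pcone_subM; [exact: pcone1X|by rewrite subKr; exact: pconeX|].
  by apply: pcone_subX; [exact: pconeX|exact: pcone1X].
have Giter m u : iter m G u = ev C (k ^+ m) (iter m Q u).
  elim: m => [|m IH] /=; first by rewrite expr0 ev1.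
  by rewrite IH Qev -evM exprS.
have Yiter m u : V u -> V (ev C (('X ^+ n.+1) ^+ m) (iter m Q u)).
  move=> Vu; elim: m => [|m IH] /=; first by rewrite expr0 ev1.
  by rewrite exprS evM -Qev -Qev; exact: VYQ.
have VG u : V u -> V (G u).
  apply: (root_stable (n := n) Gsym G0 G1 sV cV) => v Vv; rewrite Giter.
  (* Regrouped so that G^(n+1) = d^(n+1) (1 - Y) Y^n. *)
  have -> : k ^+ n.+1 = (d ^+ n.+1)%:P * (1 - 'X) ^+ n.+1 * ('X ^+ n.+1) ^+ n.
    have -> : (d ^+ n.+1)%:P = d%:P ^+ n.+1 by exact: rmorphXn.
    by rewrite /k !exprMn -exprM mulnC exprM.
  by rewrite 2!evM evC iterS -2!Qev; apply: subspZ => //; apply: VZQ; exact: Yiter.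
(* W = Y + N^*N Y preserves V and C W = Y. As W is symmetric and injective, W V is dense in V, so C
   V lies in V by continuity. *)
pose W : {linear K -> K} := Q \o ev C ('X ^+ n).
have WE u : W u = Q (ev C ('X ^+ n.+1) u) + d^-1 *: G u.
  have -> : d^-1 *: G u = Q (ev C ((1 - 'X) * 'X ^+ n) u).
    by rewrite /G /= Qev /k -mulrA [ev C (d%:P * _) _]evM evC scalerA mulVf ?scale1r // gt_eqF.
  by rewrite -linearD -evD /W /=; congr (Q (ev C _ _)); rewrite exprS; ring.
have VW u : V u -> V (W u).
  by move=> Vu; rewrite WE; apply: subspD => //; [exact: VYQ|apply: subspZ => //; exact: VG].
have CW u : C (W u) = Q (ev C ('X ^+ n.+1) u).
  by rewrite -[C _]evX /W /= -Qev -evM -exprS.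
have iterC m u : ev C ('X ^+ m) u = 0 -> u = 0.
  by elim: m => [|m IH]; rewrite ?expr0 ?ev1 // exprS evM evX => /C_inj.
have W_inj u : W u = 0 -> u = 0.
  by move=> h; apply: (iterC n); rewrite -(EQ (ev _ _ _)) [Q _]h linear0.
have W_sym u v : rip (W u) v = rip u (W v).
  have Q_sym a b : rip (Q a) b = rip a (Q b) by rewrite -{1}(EQ b) -E_sym EQ.
  by rewrite /W /= Q_sym ev_sym // Qev.
have W_dense := symmetric_dense_range W_sym W_inj sV cV VW Vx.
apply: (adh_closed (f := C) _ cV _ W_dense); first exact: cone_contraction.
by move=> _ [v Vv ->]; rewrite CW; exact: VYQ.
Qed.
End PowerRatio.

(** * Roots of quasinormal operators *)

Lemma adh_eq0 (R : realType) (H1 H2 : rhilb R) (F : {linear H1 -> H2}) (M : R) (V : H1 -> Prop) l :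
  (forall x, nm (F x) <= M * nm x) -> (forall v, V v -> F v = 0) -> adh V l -> F l = 0.
Proof.
move=> bF F0 al; apply: nm_small => e e0.
have M0 : 0 < `|M| + 1 by rewrite ltr_wpDl.
have [|v [Vv lv]] := al (e / (`|M| + 1)); first by rewrite divr_gt0.
rewrite -[F l](subrK (F v)) (F0 v) // addr0 subr0 -[l](subrK v) linearD (F0 v) // addr0.
apply: le_trans (bF _) _; move: lv; rewrite ltr_pdivlMr // => lv.
apply: le_trans (ltW lv); rewrite mulrC ler_wpM2l ?nm_ge0 //.
by apply: le_trans (ler_norm M) _; rewrite lerDl.
Qed.

Lemma ev_bounded (R : realType) (H : rhilb R) (C : {linear H -> H}) p :
  contraction C -> exists M, forall x, nm (ev C p x) <= M * nm x.
Proof.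
move=> cC; elim/poly_ind: p => [|p c [M hM]].
  by exists 0 => x; rewrite ev0 nm0 mul0r.
exists (M + `|c|) => x; rewrite evD evXM evC mulrDl; apply: le_trans (nmD _ _) _.
by rewrite nmZ lerD2r; apply: le_trans (cC _) (hM x).
Qed.

Definition quasinormal_graph (R : realType) (H : rhilb R) (S : H -> H -> Prop) :=
  forall x z, comp S (comp (adj S) S) x z <-> comp (comp (adj S) S) S x z.

Section Quasinormal.
Variables (R : realType) (H : rhilb R) (S : H -> H -> Prop) (r X : {linear H -> H}).
Hypotheses (sS : gsub S) (fS : functional S) (qS : quasinormal_graph S) (rS : resolvent S r X).

(** S S^*S r u = v - S r u, so quasinormality gives (1 + S^*S) S r u = v, that is, S r u = r v. *)
Lemma quasinormal_resolvent_comm u v : S u v -> S (r u) (r v).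
Proof.
move=> Suv; have [h1 h2] := rS u; have [|w S1 [w' S2 a1]] := proj1 (qS (r u) (v - X u)).
  by exists (u - r u); [exists (X u)|exact: gsubB].
have [e _] := resolvent_eq sS rS S2 a1.
by move: e; rewrite -(fS h1 S1) addrC subrK => <-.
Qed.

(** With h = r^2 g and w = S h: |S w|^2 = <w, S^*S w> = <w, S S^*S h> = <S^* w, S^*S h> = |S^*S
    h|^2. *)
Lemma quasinormal_square g : exists w y,
  [/\ S (r (r g)) w, S w y, adj S w (r g - r (r g)) & nm y = nm (r g - r (r g))].
Proof.
have [h1 h2] := rS g; have [h3 h4] := rS (r g); have [h5 h6] := rS (X g).
have e : X (r g) = r (X g) by apply: fS h3 _; exact: quasinormal_resolvent_comm.
exists (r (X g)), (X (X g)); rewrite -{1 2}e; split=> //; rewrite ?e //; first by rewrite -e.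
have hw : S (r g - r (r g)) (X g - r (X g)) by apply: gsubB => //; rewrite -e.
rewrite /nm -(h4 _ _ hw) e (h6 _ _ h5).
by rewrite rip_sym.
Qed.
End Quasinormal.

(** * The embedded space reduces the normal extension *)

Section Main.
Variables (R : realType) (H K : rhilb R) (J : {linear H -> K}).
Variables (T : H -> H -> Prop) (N : K -> K -> Prop) (n : nat).
Local Notation S := (relpow T n.+1).
Hypotheses (iJ : forall x y, rip (J x) (J y) = rip x y)
  (sT : gsub T) (cT : gclosed T) (fT : functional T)
  (sN : gsub N) (cN : gclosed N) (fN : functional N)
  (dN : forall y, adh (fun u => exists v, N u v) y)
  (nN : forall x z, comp (adj N) N x z <-> comp N (adj N) x z)
  (TN : forall x y, T x y -> N (J x) (J y))
  (sS : gsub S) (cS : gclosed S) (dS : forall y, adh (fun u => exists v, S u v) y)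
  (qS : quasinormal_graph S).

Let fS : functional S. Proof. by move=> x y y' h h'; exact: (relpow_functional fT h h'). Qed.
Let nJ x : nm (J x) = nm x. Proof. by rewrite /nm iJ. Qed.
Let J_inj x y : J x = J y -> x = y.
Proof. by move=> e; apply/eqP; rewrite -subr_eq0; apply/eqP/nm_eq0; rewrite -nJ linearB e subrr nm0. Qed.
Let V y := exists x, y = J x.
Let sV : subsp V.
Proof.
split=> [|a _ _ [x ->] [y ->]]; first by exists 0; rewrite linear0.
by exists (a *: x + y); rewrite linearP.
Qed.
Let cV : closedS V. Proof. exact: image_closed. Qed.
Let SN m x y : relpow T m x y -> relpow N m (J x) (J y).
Proof. by elim: m x => [|m IH] x /=; [move=> ->|move=> [z /TN h /IH h']; exists (J z)]. Qed.

Section WithResolvents.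
Variables (r Xr : {linear H -> H}) (C X : {linear K -> K}).
Hypotheses (rS : resolvent S r Xr) (rN : resolvent N C X).

Let symC := resolvent_sym rN.
Let C_ge0 := resolvent_ge0 rN.
Let C_le1 := resolvent_le1 rN.
Let C_inj x : C x = 0 -> x = 0. Proof. exact: (resolvent_inj sN rN fN dN). Qed.
Let r_inj x : r x = 0 -> x = 0. Proof. exact: (resolvent_inj sS rS fS dS). Qed.

Let r_dense x : adh (fun y => exists2 v, True & y = r v) x.
Proof. by apply: (symmetric_dense_range (resolvent_sym rS) r_inj). Qed.

(** Let h = r^2 g, a = S^*S h, b = (N^*N)^(n+1) J h. Then b - J a is orthogonal to J of the dense
    domain of S, so |b - J a|^2 = |b|^2 - |a|^2, which is at most 0 because |b| <= |S^2 h| = |a|. *)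
Let absq_lift g : iter n.+1 C (J (r g - r (r g))) = iter n.+1 (fun u => u - C u) (J (r (r g))).
Proof.
have [w [y [S1 S2 a1 ny]]] := quasinormal_square sS fS qS rS g.
set a := r g - r (r g) in a1 ny *.
have [b [<- nb [xn hxn hb]]] := absq_power sN cN fN dN nN rN (relpow_cat (SN S1) (SN S2)).
have e : xn = J w by exact: relpow_functional fN hxn (SN S1).
suff -> : b = J a by [].
have ba : rip (J a) (b - J a) = 0.
  apply: (@adh_orth _ _ (fun v => exists2 u, (exists u', S u u') & v = J u)).
    apply: (adh_map (f := J) _ _ (dS a)); first by move=> x; rewrite nJ.
    by move=> u hu; exists u.
  move=> _ [u [u' Su] ->]; rewrite ripBr iJ rip_sym (hb _ _ (SN Su)) e iJ rip_sym.
  by rewrite (a1 _ _ Su) subrr.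
apply/eqP; rewrite -subr_eq0; apply/eqP/rip_def/le_anti; rewrite rip_ge0 andbT.
have : rip b b <= rip (J a) (J a).
  by rewrite -!nm_sq ler_pXn2r ?nnegrE ?nm_ge0 // nJ -ny -nJ.
by move: ba; rewrite !ripE (rip_sym b (J a)); lra.
Qed.

Let E_inj := powsum_inj (n := n) symC C_ge0 C_le1.

(** Says J r = Y J. For g in the range of r this is [absq_lift] rearranged; both sides are bounded
    and that range is dense. *)
Let resolvent_lift g : ev C (powsum R n.+1) (J (r g)) = ev C ('X ^+ n.+1) (J g).
Proof.
pose F1 : {linear H -> K} := ev C (powsum R n.+1) \o (J \o r).
pose F2 : {linear H -> K} := ev C ('X ^+ n.+1) \o J.
pose F : {linear H -> K} := F1 \- F2.
have cC := resolvent_contractionC rN; have cr := resolvent_contractionC rS.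
have [M1 h1] := ev_bounded (powsum R n.+1) cC; have [M2 h2] := ev_bounded ('X ^+ n.+1) cC.
suff : F g = 0 by move/eqP; rewrite /F /= subr_eq0 => /eqP.
apply: (@adh_eq0 _ _ _ F (`|M1| + M2)) (r_dense g) => [x|_ [x _ ->]].
  apply: le_trans (nmD _ _) _; rewrite nmN mulrDl; apply: lerD; last by rewrite -(nJ x); exact: h2.
  apply: le_trans (h1 _) _; apply: le_trans (ler_wpM2r (nm_ge0 _) (ler_norm M1)) _.
  by rewrite ler_wpM2l // nJ.
have := absq_lift x; rewrite -(eq_iter (evX C)) -ev_exp.
have e1 u : u - C u = ev C (1 - 'X) u by rewrite evB ev1 evX.
rewrite (eq_iter e1) -ev_exp linearB linearB => /eqP; rewrite subr_eq => /eqP h.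
by rewrite /F /F1 /F2 /= h /powsum evD addrC addrC [ev C ('X^_) _ + _]addrC subrr.
Qed.

Let C_stable y : V y -> V (C y).
Proof.
apply: (power_ratio_stable symC C_ge0 C_le1 C_inj (n := n) sV cV) => _ [x ->].
by exists (J (r x)); [exists (r x)|exact: resolvent_lift].
Qed.

Let c_spec h : exists u, C (J h) = J u.
Proof. by apply: C_stable; exists h. Qed.

(** r is induced by Y, a function of C, so it commutes with the operator that C induces on H. *)
Let r_comm h u : C (J h) = J u -> C (J (r h)) = J (r u).
Proof.
move=> e; apply/eqP; rewrite -subr_eq0; apply/eqP/E_inj; rewrite linearB /= resolvent_lift -e.
have evCC p y : ev C p (C y) = C (ev C p y) by have := ev_comm C p 'X y; rewrite !evX.
by rewrite !evCC resolvent_lift subrr.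
Qed.

(* [C] and [X] map [J H] into itself and induce there the resolvent of [T]. *)
Let T_lift h : exists u t, [/\ T u t, C (J h) = J u & X (J h) = J t].
Proof.
(* The range of r lies in the domain of S = T^(n+1), hence in that of T; this settles h = r g. *)
have dense g : exists u t, [/\ T u t, C (J (r g)) = J u & X (J (r g)) = J t].
  have [u0 e0] := c_spec g; have [h1 _] := rS u0; have [t Tt _] := h1.
  exists (r u0), t; split=> //; first exact: r_comm.
  by have [h2 _] := rN (J (r g)); apply: fN h2 _; rewrite (r_comm e0); exact: TN.
have [u eu] := c_spec h.
have [t et] : V (X (J h)).
  have cXJ : contraction (X \o J) by move=> x; rewrite /= -(nJ x); exact: resolvent_contraction rN _.
  apply: (adh_closed (f := X \o J) cXJ cV _ (r_dense h)) => _ [g _ ->].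
  by have [_ [t [_ _ et]]] := dense g; exists t.
(* As r g tends to h, the pairs for r g tend to (u, t) because C and X are contractions and J is
   isometric; T is closed. *)
exists u, t; split=> //; apply: (@cT (u, t)) => e e0.
have [|_ [[g _ ->] lt]] := r_dense h (e := e / 2); first by rewrite divr_gt0.
have [u' [t' [Tu eu' et']]] := dense g; exists (u', t'); split=> //.
apply: le_lt_trans (nm_pair _) _; rewrite [e]splitr /=; apply: ltrD; apply: le_lt_trans lt.
  rewrite -nJ linearB -eu -eu' -!linearB -(nJ (h - r g)); exact: resolvent_contractionC rN _.
rewrite -nJ linearB -et -et' -!linearB -(nJ (h - r g)); exact: resolvent_contraction rN _.
Qed.

(** Testing N^* X J h = J (h - x) against J of the domain of T yields T^*T x = h - x. *)
Let T_absq h x : C (J h) = J x -> exists2 t, T x t & adj T t (h - x) /\ X (J h) = J t.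
Proof.
move=> e; have [u [t [Tu eu et]]] := T_lift h; have eux : u = x by apply: J_inj; rewrite -eu.
rewrite -eux; exists t => //; split=> // v v' Tv; have [_ h2] := rN (J h).
by rewrite -iJ -et (h2 _ _ (TN Tv)) eu -linearB iJ.
Qed.

Let T_absq_eq x a : comp (adj T) T x a -> C (J (x + a)) = J x.
Proof.
move=> [y Ty ay]; have [u eu] := c_spec (x + a); have [t Tu [au _]] := T_absq eu.
rewrite eu; congr (J _).
have := @resolvent_unique _ _ T (x + a) u t x y sT Tu au Ty.
by rewrite addrC addKr => /(_ ay)[].
Qed.

(** The points (C J g, X J g) approximate (J x, J y) and come from the graph of T by [T_lift]; T is
    closed. *)
Let T_maximal x y : N (J x) (J y) -> T x y.
Proof.
move=> Nxy; have := resolvent_core sN rN fN cN sV cV C_stable (ex_intro _ x erefl) Nxy.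
move=> al; apply: (@cT (x, y)) => e e0.
have [|_ [[_ [g ->] ->] lt]] := al (e / 2); first by rewrite divr_gt0.
have [u [t [Tu eu et]]] := T_lift g; exists (u, t); split=> //.
apply: le_lt_trans (nm_pair _) _; rewrite [e]splitr /=; apply: ltrD; apply: le_lt_trans lt.
  by rewrite -nJ linearB -eu; exact: (nm_fst ((J x, J y) - (C (J g), X (J g)) : prodh K K)).
by rewrite -nJ linearB -et; exact: (nm_snd ((J x, J y) - (C (J g), X (J g)) : prodh K K)).
Qed.

(** If q is the component of k orthogonal to V, then C q lies in V and is orthogonal to V, so C q =
    0 and q = 0. *)
Let V_of_C k : V (C k) -> V k.
Proof.
move=> VCk; have [p [ap op]] := projection k sV.
have [g eg] := cV ap.
suff -> : k = p by rewrite eg; exists g.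
have Cq : C (k - p) = 0.
  have Vq : V (C (k - p)) by rewrite linearB; apply: subspB => //; apply: C_stable; exact: cV.
  by apply: rip_def; rewrite symC; apply: op; exact: C_stable.
by apply/eqP; rewrite -subr_eq0; apply/eqP/C_inj.
Qed.

Lemma quasinormal_of_resolvents : quasinormal_graph T.
Proof.
move=> x z; split.
  (* C commutes with N: applied to N J (x + a) = J (x' + z), it gives C J (x' + z) = N J x = J x',
     hence T^*T x' = z. *)
  move=> [a Bxa Taz]; have ex := T_absq_eq Bxa; have [x' Tx ax] := Bxa.
  have Tg : T (x + a) (x' + z) by exact: gsubD.
  have := normal_resolvent_comm sN nN rN (TN Tg); rewrite ex => N1.
  have ex' : C (J (x' + z)) = J x' by exact: fN N1 (TN Tx).
  exists x' => //; have [t Tt [at' _]] := T_absq ex'; exists t => //.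
  by move: at'; rewrite addrC addKr.
(* Conversely N^*N J x' = J z, so by normality N w = J z for w = N^* J x' = N^*N J x. [V_of_C] puts
   w in J H, and maximality brings N w = J z back to T. *)
move=> [x' Tx Bx]; have ex' := T_absq_eq Bx.
have [t Tt [_ et]] := T_absq ex'; have [N1 a1] := rN (J (x' + z)).
have Bx' : comp (adj N) N (J x') (J z).
  exists (X (J (x' + z))); first by rewrite -ex'.
  have ez : J (x' + z) - J x' = J z by rewrite linearD addrC addKr.
  by move: a1; rewrite ex' ez.
have [w aw Nw] := proj1 (nN _ _) Bx'.
have [eC _] := resolvent_eq sN rN (TN Tx) aw.
have [b eb] : V (J x + w) by apply: V_of_C; rewrite -eC; exists x.
have ew : w = J (b - x) by rewrite linearB -eb addrC addKr.
exists (b - x); last by apply: T_maximal; rewrite -ew.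
have exb : C (J b) = J x by rewrite -eb.
by have [t' Tt' [at' _]] := T_absq exb; exists t'.
Qed.
End WithResolvents.

Theorem quasinormal_root : quasinormal_graph T.
Proof.
have [r [Xr rS]] := resolvent_exists sS cS; have [C [X rN]] := resolvent_exists sN cN.
exact: quasinormal_of_resolvents rS rN.
Qed.
End Main.

(** * Complex Hilbert spaces as real ones *)

Section Realification.
Variable R : realType.
Local Open Scope complex_scope.
Local Notation C := R[i].

(** A separate alias keeps the real module structure from clashing with the complex one on the same
    carrier. *)
Definition realified (K : hilbertSpace R) : Type := K.
HB.instance Definition _ (K : hilbertSpace R) := GRing.Zmodule.copy (realified K) (hcar K).

Section Lmodule.
Variable K : hilbertSpace R.
Definition real_scale (a : R) (x : realified K) : realified K := a%:C *: (x : K).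
Lemma real_scaleA a b x : real_scale a (real_scale b x) = real_scale (a * b) x.
Proof. by rewrite /real_scale scalerA -rmorphM. Qed.
Lemma real_scale1 : left_id 1 real_scale.
Proof. by move=> x; rewrite /real_scale scale1r. Qed.
Lemma real_scaleDr : right_distributive real_scale +%R.
Proof. by move=> a x y; rewrite /real_scale scalerDr. Qed.
Lemma real_scaleDl x : {morph real_scale^~ x : a b / a + b}.
Proof. by move=> a b; rewrite /real_scale rmorphD scalerDl. Qed.
HB.instance Definition _ :=
  GRing.Zmodule_isLmodule.Build R (realified K) real_scaleA real_scale1 real_scaleDr real_scaleDl.
End Lmodule.

Section RealHilbert.
Variable K : hilbertSpace R.
Implicit Types x y z : realified K.

Definition re_ip x y : R := complex.Re (@hip R K x y).

Lemma hip_re x : @hip R K x x = (re_ip x x)%:C.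
Proof.
have := hip_ge0 (x : K); rewrite /re_ip; case: (hip _ _) => a b.
by rewrite lecE /= => /andP[/eqP -> _].
Qed.

Lemma re_ip_linl a x y z : re_ip (a *: x + y) z = a * re_ip x z + re_ip y z.
Proof.
rewrite /re_ip [X in complex.Re X](@hip_linl R K a%:C x y z).
by case: (hip _ _) => p q; case: (hip _ _) => s t /=; rewrite mul0r subr0.
Qed.
Lemma re_ip_sym x y : re_ip y x = re_ip x y.
Proof. by rewrite /re_ip (@hip_sym R K x y); case: (@hip R K x y). Qed.
Lemma re_ip_ge0 x : 0 <= re_ip x x.
Proof. by have := hip_ge0 (x : K); rewrite hip_re lecR. Qed.
Lemma re_ip_def x : re_ip x x = 0 -> x = 0.
Proof. by move=> h; apply: (@hip_def R K); rewrite hip_re h. Qed.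

(** In the order of R[i] a positive number has zero imaginary part. *)
Lemma posc (e : C) : 0 < e -> 0 < complex.Re e /\ e = (complex.Re e)%:C.
Proof. by case: e => a b; rewrite ltcE /= => /andP[/eqP -> h]. Qed.

Lemma re_ip_complete (u : nat -> realified K) :
  (forall e : R, 0 < e -> exists N, forall m k, (N <= m)%N -> (N <= k)%N ->
     re_ip (u m - u k) (u m - u k) < e) ->
  exists l, forall e : R, 0 < e -> exists N, forall m, (N <= m)%N ->
     re_ip (u m - l) (u m - l) < e.
Proof.
move=> hu; have [|l hl] := @hcomplete R K u.
  move=> e /posc[e0 ->]; have [N hN] := hu _ e0; exists N => m k hm hk.
  by rewrite /sqnorm hip_re ltcR; exact: hN.
exists l => e e0; have [|N hN] := hl e%:C; first by rewrite ltcR.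
by exists N => m hm; have := hN m hm; rewrite /sqnorm hip_re ltcR.
Qed.

Definition real_hilbert : rhilb R :=
  RHilb re_ip_linl re_ip_sym re_ip_ge0 re_ip_def re_ip_complete.

Lemma sqnorm_nm (x : real_hilbert) (e : R) : 0 < e ->
  (sqnorm (@hip R K) x < (e ^+ 2)%:C) = (nm x < e).
Proof.
by move=> e0; rewrite /sqnorm hip_re ltcR -[re_ip x x]/(rip x x) -nm_sq ltr_pXn2r ?nnegrE ?nm_ge0 // ltW.
Qed.
End RealHilbert.

(** * Operators with domain as graphs *)

Section Graph.
Variable K : hilbertSpace R.
Local Notation KR := (real_hilbert K).
Implicit Types T S : op K.

(** Forgets the values of [app T] outside the domain, so that [op_eq] becomes equivalence of
    relations. *)
Definition graph T : KR -> KR -> Prop := fun x y => dom T x /\ app T x = y.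

Lemma graph_functional T : functional (graph T).
Proof. by move=> x y y' [_ <-] [_ <-]. Qed.

Lemma graph_sub T : linear_op T -> gsub (graph T).
Proof.
move=> [[d0 dL] aL]; split=> [|a [x x'] [y y'] /= [dx <-] [dy <-]].
  split=> //=; have := aL (-1) 0 0 d0 d0; rewrite scaler0 addr0 scaleN1r => h.
  by rewrite [LHS]h addNr.
by split; [exact: dL|exact: aL].
Qed.

Lemma graph_dense T : densely_defined T -> forall y, adh (fun u => exists v, graph T u v) y.
Proof.
move=> dT y e e0; have [|u [du h]] := dT y (e ^+ 2)%:C; first by rewrite ltcR exprn_gt0.
by exists u; split; [exists (app T u)|rewrite -sqnorm_nm].
Qed.

Lemma graph_closed T : closed_op T -> gclosed (graph T).
Proof.
move=> cT [x y] al.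
have /choice[u hu] (m : nat) : exists p : KR * KR, graph T p.1 p.2 /\ nm (((x, y) : prodh KR KR) - p) < m.+1%:R^-1.
  by have [|p hp] := al m.+1%:R^-1; [rewrite invr_gt0 ltr0n|exists p].
have cv (f : nat -> KR) z : (forall m, nm (z - f m) < m.+1%:R^-1) -> seq_converges (@hip R K) f z.
  move=> hf e /posc[e0 ->]; have s0 : 0 < Num.sqrt (complex.Re e) by rewrite sqrtr_gt0.
  have [N hN] := small_inv s0; exists N => m hm.
  have -> : complex.Re e = Num.sqrt (complex.Re e) ^+ 2 by rewrite sqr_sqrtr // ltW.
  by rewrite (@sqnorm_nm K (f m - z)) // nmB; apply: lt_trans (hf m) (hN _ hm).
apply: (cT (fun m => (u m).1) x y) => [m||]; first by case: (hu m) => -[].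
  by apply: cv => m; have [_] := hu m; apply: le_lt_trans; exact: (nm_fst ((x, y) - u m : prodh KR KR)).
have e m : app T (u m).1 = (u m).2 by case: (hu m) => -[].
apply: cv => m; rewrite e; have [_] := hu m.
by apply: le_lt_trans; exact: (nm_snd ((x, y) - u m : prodh KR KR)).
Qed.

(** The real adjoint is the complex one: the real identity at 'i x recovers the imaginary part of
    the identity at x. *)
Lemma graph_adj_rel T (y z : K) : linear_op T -> adj_rel T y z <-> adj (graph T) y z.
Proof.
move=> [[_ dL] aL]; split=> [h u v [du <-]|h x dx].
  by rewrite /rip /= /re_ip (h _ du).
have re x' : dom T x' -> complex.Re (hip (app T x') y) = complex.Re (hip x' z).
  by move=> dx'; exact: (h x' (app T x') (conj dx' erefl)).
have d0 : dom T 0 by have := dL (-1) x x dx dx; rewrite scaleN1r addNr.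
have := re _ (dL 'i x 0 dx d0); rewrite (aL _ _ _ dx d0) !hip_linl.
have z0 (w : K) : hip (0 : K) w = 0 :> C.
  by have := @hip_linl R K (-1) 0 0 w; rewrite scaler0 addr0 mulN1r addNr.
have -> : app T 0 = 0 by have := aL (-1) 0 0 d0 d0; rewrite scaler0 addr0 scaleN1r addNr.
move: (re _ dx); rewrite !z0 !addr0; case: (hip (app T x) y) => a b; case: (hip x z) => c d /=.
by move=> ->; rewrite !mul0r !mul1r !sub0r => /oppr_inj ->.
Qed.

Lemma graph_comp S T : graph (op_comp S T) = comp (graph S) (graph T).
Proof.
apply/funext => x; apply/funext => z; apply/propext; split.
  by move=> [[h1 h2] <-]; exists (app T x).
by move=> [_ [h1 <-] [h2 <-]].
Qed.

Lemma graph_pow T n : graph (op_pow T n) = relpow (graph T) n.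
Proof.
elim: n => [|n IH].
  by apply/funext => x; apply/funext => z; apply/propext; split=> [[]|].
by rewrite [LHS]graph_comp IH.
Qed.

(** The value picked by [epsilon] is an adjoint value, and density of the domain makes it the only
    one. *)
Lemma graph_adj T : linear_op T -> densely_defined T -> graph (op_adj T) = adj (graph T).
Proof.
move=> lT dT; apply/funext => y; apply/funext => z; apply/propext.
have sp w : adj_rel T y w -> adj_rel T y (app (op_adj T) y).
  by move=> h; apply: ClassicalEpsilon.epsilon_spec; exists w.
split=> [[[w hw] <-]|/(graph_adj_rel _ _ lT) h]; first exact/graph_adj_rel/(sp w).
split; first by exists z.
apply: (adj_functional (graph_dense dT)) (y : KR) _ _ _ _; apply/graph_adj_rel => //.
exact: sp h.
Qed.

Lemma op_eq_graph S T : op_eq S T <-> forall x z, graph S x z <-> graph T x z.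
Proof.
split=> [[hd ha] x z|h].
  by split=> [[d <-]|[d <-]]; split; rewrite -?ha //; apply/hd.
split=> [x|x dx]; last by have [_ ->] := proj1 (h x _) (conj dx erefl).
by split=> dx; [have [] := proj1 (h x _) (conj dx erefl)|have [] := proj2 (h x _) (conj dx erefl)].
Qed.

Lemma quasinormal_graphP S : closed_densely_defined S ->
  op_eq (op_comp S (op_comp (op_adj S) S)) (op_comp (op_comp (op_adj S) S) S)
  <-> quasinormal_graph (graph S).
Proof.
by move=> [lS [dS _]]; rewrite op_eq_graph !graph_comp graph_adj.
Qed.
End Graph.
End Realification.

Theorem theorem1p7 (R : realType) (H : hilbertSpace R) (T : op H) (n : nat) :
  closed_densely_defined T -> (1 < n)%N ->
  subnormal T -> quasinormal (op_pow T n) ->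
  quasinormal T.
Proof.
move=> cdT; case: n => // n _ [_ [_ [K [J0 [N [[J0lin J0iso] [[cdN nN] TN]]]]]]] [cdS qS].
split=> //; apply/quasinormal_graphP => //.
have [lT [dT cT]] := cdT; have [lN [dN cN]] := cdN; have [lS [dS cS]] := cdS.
have [J hJ] : exists J : {linear real_hilbert H -> real_hilbert K}, J =1 J0.
  by apply: make_linear => a x y; exact: J0lin.
move/(quasinormal_graphP cdS): qS; have := graph_dense dS.
have := graph_sub lS; have := graph_closed cS; rewrite !graph_pow => cS' sS' dS' qS'.
have iJ x y : rip (J x) (J y) = rip x y by rewrite !hJ /rip /= /re_ip J0iso.
apply: (@quasinormal_root R _ _ J (graph T) (graph N) n iJ) => //.
- exact: graph_sub.
- exact: graph_closed.
- exact: graph_functional.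
- exact: graph_sub.
- exact: graph_closed.
- exact: graph_functional.
- exact: graph_dense.
- by move/op_eq_graph: nN; rewrite !graph_comp graph_adj.
- by move=> x y [dx <-]; rewrite !hJ; have [d e] := TN x dx; split.
Qed.
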